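(* Let $A$ be an $m\times m$ $M$-matrix. Then, for all $I,J\subset[m]$, $$\operatorname{tr} A[I]^p+\operatorname{tr} A[J]^p\ \ge\ \operatorname{tr} A[I\cup J]^p+\operatorname{tr} A[I\cap J]^p\quad\text{for } 0\le p\le 1,$$ $$\operatorname{tr} A[I]^p+\operatorname{tr} A[J]^p\ \le\ \operatorname{tr} A[I\cup J]^p+\operatorname{tr} A[I\cap J]^p\quad\text{for } p<0\text{ or }1\le p\le 2,$$ and $$\operatorname{tr}\big(A[I]\log A[I]\big)+\operatorname{tr}\big(A[J]\log A[J]\big)\ \le\ \operatorname{tr}\big(A[I\cup J]\log A[I\cup J]\big)+\operatorname{tr}\big(A[I\cap J]\log A[I\cap J]\big).$$
   Context: $[m]=\{1,\dots,m\}$. For $I\subset[m]$, $A[I]$ is the principal submatrix of $A$ with rows and columns indexed by $I$, and $A[I]^p$ means $(A[I])^p$; the trace of any function of $A[\emptyset]$ is $0$. A matrix $A\in\mathbb{R}^{m\times m}$ is an $M$-matrix if all off-diagonal entries of $A$ are nonpositive and all principal minors of $A$ are nonnegative; equivalently, $A=s\,\mathrm{Id}-B$ for some entrywise nonnegative matrix $B\in\mathbb{R}^{m\times m}$ and some $s\ge\rho(B)$, where $\rho$ is the spectral radius. $A=s\,\mathrm{Id}-B$ is invertible iff $s>\rho(B)$. Principal submatrices of an ($M$-matrix, invertible $M$-matrix) are again ($M$-matrices, invertible $M$-matrices). For an invertible $M$-matrix $A=s\,\mathrm{Id}-B$ and $p\in\mathbb{R}$, define (by absolutely convergent series) $$A^p=s^p\sum_{i=0}^\infty\binom{p}{i}(-s)^{-i}B^i,\qquad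 \log A=(\log s)\,\mathrm{Id}-\sum_{i=1}^\infty\frac{1}{i s^i}B^i .$$ For a singular $M$-matrix $A=s\,\mathrm{Id}-B$ ($s=\rho(B)$): $\operatorname{tr}A^p:=\lim_{t\to s^+}\operatorname{tr}(t\,\mathrm{Id}-B)^p$ for $p>0$; $\operatorname{tr}A^0:=\lim_{p\searrow0}\operatorname{tr}A^p$; $\operatorname{tr}A^p:=+\infty$ for $p<0$; and $\operatorname{tr}(A\log A):=\lim_{t\to s^+}\operatorname{tr}\big((t\,\mathrm{Id}-B)\log(t\,\mathrm{Id}-B)\big)$. For $p<0$ the inequality is understood in $(-\infty,+\infty]$. *)

(* Defs.v *)
From HB Require Import structures.
From mathcomp Require Import all_boot all_order all_algebra.
From mathcomp Require Import all_classical all_reals all_analysis.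

Set Implicit Arguments.
Unset Strict Implicit.
Unset Printing Implicit Defensive.

Import Order.TTheory GRing.Theory Num.Theory.
Import numFieldNormedType.Exports.
Local Open Scope classical_set_scope.
Local Open Scope ring_scope.

Section Functions.
Context {R : realType}.

Definition principal_submx m (A : 'M[R]_m) (I : {set 'I_m}) : 'M[R]_#|I| :=
  mxsub (enum_val : 'I_#|I| -> 'I_m) (enum_val : 'I_#|I| -> 'I_m) A.

Definition M_matrix m (A : 'M[R]_m) : Prop :=
  (forall i j, i != j -> A i j <= 0) /\
  (forall I : {set 'I_m}, 0 <= \det (principal_submx A I)).

Definition rbinom (p : R) (i : nat) : R :=
  (\prod_(j < i) (p - j%:R)) / i`!%:R.

(* (s Id - B)^p and log (s Id - B), as functions of the splitting (s, B). The
   series converge absolutely when B is entrywise nonnegative and s > rho(B). *)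
Definition split_pow n (s : R) (B : 'M[R]_n) (p : R) : 'M[R]_n :=
  s `^ p *: limn (series (fun i => (rbinom p i * (- s) ^- i) *: B ^+ i)).

Definition split_log n (s : R) (B : 'M[R]_n) : 'M[R]_n :=
  (ln s)%:M
  - limn (series (fun i => (i.+1%:R * s ^+ i.+1)^-1 *: B ^+ i.+1)).

(* Every M-matrix has the splitting A = s Id - B with s = max (0, max_i A i i)
   and B = s Id - A entrywise nonnegative. The admissible values of s are those
   at or above this one (all s in dimension 0); A^p and log A do not depend on
   which of them is used. For an M-matrix every such s satisfies s >= rho(B),
   with equality iff A is singular. *)
Definition split_scalar n (A : 'M[R]_n) : R := \big[Num.max/0]_(i < n) A i i.

Definition split_rest n (A : 'M[R]_n) : 'M[R]_n := (split_scalar A)%:M - A.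

Lemma split_rest_ge0 n (A : 'M[R]_n) :
  M_matrix A -> forall i j, 0 <= split_rest A i j.
Proof.
move=> [offA _] i j; rewrite !mxE; have [<-|/offA] := eqVneq i j; last first.
  by rewrite mulr0n add0r oppr_ge0.
by rewrite mulr1n subr_ge0 /split_scalar (bigD1 i) //= le_max lexx.
Qed.

Lemma split_scalarK n (A : 'M[R]_n) : A = (split_scalar A)%:M - split_rest A.
Proof. by rewrite /split_rest opprB addrC subrK. Qed.

(* A^p and log A for an invertible M-matrix A. *)
Definition mx_pow n (A : 'M[R]_n) (p : R) : 'M[R]_n :=
  split_pow (split_scalar A) (split_rest A) p.

Definition mx_log n (A : 'M[R]_n) : 'M[R]_n :=
  split_log (split_scalar A) (split_rest A).

(* tr A^p for a singular M-matrix A and p > 0. *)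
Definition sing_tr_pow n (A : 'M[R]_n) (p : R) : R :=
  lim (\tr (split_pow t (split_rest A) p) @[t --> (split_scalar A)^'+]).

(* The empty matrix is invertible (its determinant is 1), so all its traces
   are 0. *)
Definition tr_pow n (A : 'M[R]_n) (p : R) : \bar R :=
  if A \in unitmx then (\tr (mx_pow A p))%:E
  else if p < 0 then +oo%E
  else if p == 0 then (lim (sing_tr_pow A q @[q --> (0 : R)^'+]))%:E
  else (sing_tr_pow A p)%:E.

Definition tr_mul_log n (A : 'M[R]_n) : R :=
  if A \in unitmx then \tr (A *m mx_log A)
  else lim (\tr ((t%:M - split_rest A) *m split_log t (split_rest A))
             @[t --> (split_scalar A)^'+]).

End Functions.

(* Main.v *)
Require Import Defs.
From HB Require Import structures.
From mathcomp Require Import all_boot all_order all_algebra.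
From mathcomp Require Import all_classical all_reals all_analysis.
From mathcomp Require Import ring lra.
From mathcomp Require complex.

Set Implicit Arguments.
Unset Strict Implicit.
Unset Printing Implicit Defensive.

Import Order.TTheory GRing.Theory Num.Theory.
Import numFieldNormedType.Exports.
Local Open Scope ring_scope.

(**
  Write an M-matrix as A = s - B with B entrywise nonnegative, and let f be one
  of t^p (p < 0 or 1 <= p <= 2), - t^p (0 <= p <= 1), t ln t. The Taylor formula
  f (s - x) = sum_i phi_i(s) x^i gives

    tr f (A[I]) = sum_i phi_i(s) tr (B[I]^i),

  and two facts make this expression supermodular in I. For these f one has
  phi_i >= 0 as soon as i >= 2, because f'' is completely monotone. And
  tr (B[I]^i) counts, with nonnegative weights, the closed walks of length i that
  stay in I: the walks in the union of I and J include those in I and those in J,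
  and the walks common to these two families are those in the intersection, so
  that I |-> tr (B[I]^i) is supermodular (exp_supermodular,
  tr_exp_supermodular). For i = 0 and i = 1 it is modular, and the sign of phi_i
  does not matter. This is trace_series_supermodular.

  The rest of the work justifies the use of one scalar s for the four
  submatrices, and the passage to limits.

  - Independence of the splitting. The partial sums of sum_i phi_i(t) b_i(t),
    where b_i(t) = tr ((t - C)^i), have a derivative reduced to the single term
    - N phi_N(t) b_(N-1)(t), since phi_i' = - (i + 1) phi_(i+1) and
    b_i' = i b_(i-1) (taylor_sum_derive). The positivity of the phi_i alone bounds
    this remainder, so that the sum does not depend on t (taylor_series_indep).

  - Convergence for t > s. The principal minors of A + e are positive for e > 0,
    by multilinearity (det_rowmask_gt0). Hence (A + e)^-1 is nonnegative
    (Z_inverse_positive), and y = (A + e)^-1 1 satisfies B y <= r y with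
    r < s + e, so that B^k = O(r^k) (rho_lt_supersolution). If A is invertible
    this remains true for e = 0.

  - Limits at s when A is singular. Diagonal entries of B^k are at most s^k
    (diag_exp_le), and the series sum_i phi_i(s) s^i converges when f (0+) is
    finite (tail_bounded_at0). Monotone convergence then gives the limit for t
    decreasing to s (taylor_series_right_cvg).

  - The limit q -> 0 that defines tr A^0. The normalized traces tr (B^i) / s^i
    are sums of powers of complex numbers of modulus at most 1, so that they
    differ from a constant mu by a sequence with bounded partial sums
    (trace_exp_mean). The binomial coefficients of exponent q and positive index
    decrease in absolute value, have sum 1 up to sign and start with q. By Abel
    summation the trace of A^q tends to n - mu (binom_series_near).
*)

(** * Entrywise nonnegative matrices and principal minors *)

Section EntrywiseOrder.
Context {R : realDomainType}.

Definition lemx m n (A B : 'M[R]_(m, n)) := forall i j, A i j <= B i j.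

Lemma lemx_trans m n (B A C : 'M[R]_(m, n)) : lemx A B -> lemx B C -> lemx A C.
Proof. by move=> AB BC i j; exact: le_trans (AB i j) (BC i j). Qed.

Lemma mulmx_ge0 m n p (A : 'M[R]_(m, n)) (B : 'M[R]_(n, p)) :
  lemx 0 A -> lemx 0 B -> lemx 0 (A *m B).
Proof.
move=> A0 B0 i j; rewrite !mxE; apply: sumr_ge0 => k _.
by apply: mulr_ge0; [have := A0 i k|have := B0 k j]; rewrite mxE.
Qed.

Lemma lemx_mul m n p (A A' : 'M[R]_(m, n)) (B B' : 'M[R]_(n, p)) :
  lemx 0 A -> lemx 0 B -> lemx A A' -> lemx B B' ->
  lemx (A *m B) (A' *m B').
Proof.
move=> A0 B0 AA BB i j; rewrite !mxE; apply: ler_sum => k _.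
by apply: ler_pM => //; [have := A0 i k|have := B0 k j]; rewrite mxE.
Qed.

Lemma expmx_ge0 n (B : 'M[R]_n) k : lemx 0 B -> lemx 0 (B ^+ k).
Proof.
move=> B0; elim: k => [|k IH] i j; first by rewrite !mxE ler0n.
by rewrite exprS; exact: mulmx_ge0.
Qed.

Lemma lemx_exp n (A B : 'M[R]_n) k :
  lemx 0 A -> lemx A B -> lemx (A ^+ k) (B ^+ k).
Proof.
move=> A0 AB; elim: k => [|k IH] //; rewrite !exprS.
by apply: lemx_mul => //; exact: expmx_ge0.
Qed.

(** Writing D k for d^k + a^k - b^k - c^k, one has
    D k.+1 = D k d + b^k (d - b) + c^k (d - c) - a^k (d - a), and the last
    three terms dominate a^k (d + a - b - c), which is nonnegative. *)
Lemma exp_supermodular n (a b c d : 'M[R]_n) k :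
  lemx 0 a -> lemx a b -> lemx a c -> lemx b d -> lemx c d ->
  lemx (b + c) (d + a) -> lemx (b ^+ k + c ^+ k) (d ^+ k + a ^+ k).
Proof.
move=> a0 ab ac bd cd bcda.
have d0 : lemx 0 d by apply: lemx_trans bd; apply: lemx_trans ab.
elim: k => [|k IH]; first by move=> i j; rewrite !expr0.
have H1 : lemx 0 ((d ^+ k + a ^+ k - b ^+ k - c ^+ k) *m d).
  by apply: mulmx_ge0 => // i j; have := IH i j; rewrite !mxE; lra.
have H2 : lemx 0 ((b ^+ k - a ^+ k) *m (d - b)).
  apply: mulmx_ge0 => i j; last by have := bd i j; rewrite !mxE; lra.
  by have := lemx_exp k a0 ab i j; rewrite !mxE; lra.
have H3 : lemx 0 ((c ^+ k - a ^+ k) *m (d - c)).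
  apply: mulmx_ge0 => i j; last by have := cd i j; rewrite !mxE; lra.
  by have := lemx_exp k a0 ac i j; rewrite !mxE; lra.
have H4 : lemx 0 (a ^+ k *m (d + a - b - c)).
  apply: mulmx_ge0; first exact: expmx_ge0.
  by move=> i j; have := bcda i j; rewrite !mxE; lra.
have E : d ^+ k.+1 + a ^+ k.+1 - (b ^+ k.+1 + c ^+ k.+1) =
   (d ^+ k + a ^+ k - b ^+ k - c ^+ k) *m d + (b ^+ k - a ^+ k) *m (d - b)
   + (c ^+ k - a ^+ k) *m (d - c) + a ^+ k *m (d + a - b - c).
  rewrite !exprSr -!mulmxE !mulmxBl !mulmxBr !mulmxDl !mulmxDr.
  by apply/matrixP => i j; rewrite !mxE; lra.
move=> i j; have := congr1 (fun M : 'M[R]_n => M i j) E.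
by have := H1 i j; have := H2 i j; have := H3 i j; have := H4 i j; rewrite !mxE; lra.
Qed.

End EntrywiseOrder.

Section PrincipalTraces.
Context {R : realType}.

Lemma mxtrace_expC m n (X : 'M[R]_(m, n)) (Y : 'M[R]_(n, m)) k :
  \tr ((X *m Y) ^+ k.+1) = \tr ((Y *m X) ^+ k.+1).
Proof.
have E : (X *m Y) ^+ k.+1 = X *m ((Y *m X) ^+ k *m Y).
  elim: k => [|k IH]; first by rewrite expr1 expr0 mul1mx.
  by rewrite exprS IH exprS -!mulmxE !mulmxA.
by rewrite E mxtrace_mulC exprSr -mulmxE mulmxA.
Qed.

Definition colmask n (B : 'M[R]_n) (I : {set 'I_n}) : 'M[R]_n :=
  \matrix_(i, j) (B i j *+ (j \in I)).

(** With E the matrix selecting the rows in I, the left-hand side is the trace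
    of a power of E (B E^T), hence that of the same power of (B E^T) E, and
    E^T E masks the columns outside I. All the index sets are thus handled by
    matrices of one size. *)
Lemma tr_exp_principal n (B : 'M[R]_n) (I : {set 'I_n}) k :
  \tr (principal_submx B I ^+ k.+1) = \tr (colmask B I ^+ k.+1).
Proof.
pose E : 'M[R]_(#|I|, n) := \matrix_(i, j) (enum_val i == j)%:R.
have -> : principal_submx B I = E *m (B *m E^T).
  apply/matrixP => i j; rewrite !mxE (bigD1 (enum_val i)) //= big1.
    rewrite !mxE eqxx mul1r addr0 (bigD1 (enum_val j)) //= big1.
      by rewrite !mxE eqxx mulr1 addr0.
    by move=> k' /negbTE kj; rewrite !mxE eq_sym kj mulr0.
  by move=> k' /negbTE ki; rewrite !mxE eq_sym ki mul0r.
rewrite mxtrace_expC; congr (\tr (_ ^+ _)).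
apply/matrixP => i j; rewrite -mulmxA !mxE (bigD1 j) //= big1 => [|l lj]; last first.
  rewrite !mxE big1 ?mulr0 // => q _; rewrite !mxE.
  by case: eqP => [->|_]; rewrite ?(negbTE lj) ?mul0r ?mulr0.
rewrite addr0 !mxE; case: (boolP (j \in I)) => jI.
  rewrite (bigD1 (enum_rank_in jI j)) //= big1 => [|q].
    by rewrite !mxE enum_rankK_in // eqxx mulr1 addr0 mulr1 mulr1n.
  rewrite !mxE => qj; case: eqP => [E'|_]; last by rewrite mul0r.
  by case/eqP: qj; apply: enum_val_inj; rewrite E' enum_rankK_in.
rewrite big1 ?mulr0 ?mulr0n // => q _; rewrite !mxE.
by case: eqP => [E'|_]; [move: jI; rewrite -E' enum_valP|rewrite mul0r].
Qed.

Lemma tr_exp_supermodular n (B : 'M[R]_n) (I J : {set 'I_n}) k : lemx 0 B ->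
  \tr (colmask B I ^+ k) + \tr (colmask B J ^+ k) <=
  \tr (colmask B (I :|: J) ^+ k) + \tr (colmask B (I :&: J) ^+ k).
Proof.
move=> B0; have B0' i j : 0 <= B i j by have := B0 i j; rewrite mxE.
rewrite -!mxtraceD; apply: ler_sum => i _.
apply: exp_supermodular => {i} i j; rewrite !mxE !inE;
  by case: (j \in I); case: (j \in J); rewrite /= ?mulr0n ?mulr1n ?addr0 ?add0r.
Qed.

Lemma tr_colmask_modular n (B : 'M[R]_n) (I J : {set 'I_n}) :
  \tr (colmask B I) + \tr (colmask B J) =
  \tr (colmask B (I :|: J)) + \tr (colmask B (I :&: J)).
Proof.
rewrite -!mxtraceD; apply: eq_bigr => i _; rewrite !mxE !inE.
by case: (i \in I); case: (i \in J); rewrite /= ?mulr0n ?mulr1n ?addr0 ?add0r.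
Qed.

End PrincipalTraces.

Section PrincipalMinors.
Context {R : realFieldType}.

Lemma det_add1_mulC m n (X : 'M[R]_(m, n)) (Y : 'M[R]_(n, m)) :
  \det (1%:M + X *m Y) = \det (1%:M + Y *m X).
Proof.
have E1 : block_mx 1%:M X (- Y) 1%:M =
    block_mx 1%:M 0 (- Y) 1%:M *m block_mx 1%:M X 0 (1%:M + Y *m X).
  rewrite mulmx_block ?mul1mx ?mulmx1 ?mul0mx ?mulmx0 ?addr0 mulNmx.
  by rewrite addrCA addNr addr0.
have E2 : block_mx 1%:M X (- Y) 1%:M =
    block_mx (1%:M + X *m Y) X 0 1%:M *m block_mx 1%:M 0 (- Y) 1%:M.
  rewrite mulmx_block ?mul1mx ?mulmx1 ?mul0mx ?mulmx0 ?add0r mulmxN.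
  by rewrite addrK.
have := congr1 determinant E1; rewrite {1}E2 !det_mulmx !det_lblock !det_ublock.
by rewrite !det1 !mul1r !mulr1.
Qed.

(** The determinant of this matrix is the principal minor of A on K; as all
    these matrices have the same size, minors on different sets can be related
    by multilinearity of the determinant in the rows. *)
Definition rowmask n (A : 'M[R]_n) (K : {set 'I_n}) : 'M[R]_n :=
  \matrix_(i, j) (if i \in K then A i j else (i == j)%:R).

(** With F the matrix of f, both sides are of the form det (1 + X Y) and
    det (1 + Y X), where X = F^T and Y = F (A - 1). Only the range of f matters,
    so that iterated principal submatrices need no sorting of the indices. *)
Lemma det_mxsub_rowmask k n (f : 'I_k -> 'I_n) (A : 'M[R]_n) : injective f ->
  \det (mxsub f f A) = \det (rowmask A [set f i | i in [set: 'I_k]]).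
Proof.
move=> finj.
pose F : 'M[R]_(k, n) := \matrix_(i, j) (f i == j)%:R.
have FM (Z : 'M[R]_n) i j : (F *m Z) i j = Z (f i) j.
  rewrite mxE (bigD1 (f i)) //= big1 => [|l /negbTE li].
    by rewrite mxE eqxx mul1r addr0.
  by rewrite mxE eq_sym li mul0r.
have -> : mxsub f f A = 1%:M + (F *m (A - 1%:M)) *m F^T.
  apply/matrixP => i j; rewrite !mxE (bigD1 (f j)) //= big1 => [|l /negbTE li].
    by rewrite FM !mxE eqxx mulr1 addr0 (inj_eq finj) subrKC.
  by rewrite [F^T _ _]mxE [F _ _]mxE eq_sym li mulr0.
rewrite det_add1_mulC; congr (\det _); apply/matrixP => i j; rewrite !mxE.
case: imsetP => [[l _ ->]|iK].
  rewrite (bigD1 l) //= big1 => [|q /negbTE ql].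
    by rewrite FM !mxE eqxx mul1r addr0 subrKC.
  by rewrite [F^T _ _]mxE [F _ _]mxE (inj_eq finj) ql mul0r.
rewrite big1 ?addr0 // => l _; rewrite [F^T _ _]mxE [F _ _]mxE.
by case: eqP => [E|_]; [case: iK; exists l|rewrite mul0r].
Qed.

(** Multilinearity in row k splits a minor whose k-th diagonal entry is
    increased by d k into the old minor plus d k times the minor without k.
    Once the diagonal has been increased on all of I, the product of the d i
    is a positive term of the expansion. *)
Lemma det_rowmask_gt0 n (A : 'M[R]_n) (d : 'I_n -> R) :
  (forall I, 0 <= \det (rowmask A I)) -> (forall i, 0 < d i) ->
  forall I, 0 < \det (rowmask (A + diag_mx (\row_i d i)) I).
Proof.
move=> A0 d0.
pose AK (K : {set 'I_n}) := A + diag_mx (\row_i (d i *+ (i \in K))).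
suff H N : forall K I : {set 'I_n}, #|K| = N ->
    0 <= \det (rowmask (AK K) I) /\
    (I \subset K -> 0 < \det (rowmask (AK K) I)).
  move=> I; have [_ /(_ (finset.subsetT _))] := H _ [set: 'I_n] I erefl.
  by congr (0 < \det (rowmask (_ + diag_mx _) _)); apply/rowP => i; rewrite !mxE inE.
elim: N => [|N IH] K I cK.
  move/eqP: cK; rewrite cards_eq0 => /eqP ->.
  have -> : AK finset.set0 = A.
    by apply/matrixP => i j; rewrite !mxE inE mulr0n mul0rn addr0.
  split => //; rewrite finset.subset0 => /eqP ->.
  suff -> : rowmask A finset.set0 = 1%:M by rewrite det1.
  by apply/matrixP => i j; rewrite !mxE inE.
have /card_gt0P[k kK] : (0 < #|K|)%N by rewrite cK.
have cK' : #|K :\ k| = N by move: cK; rewrite (cardsD1 k) kK => -[].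
case: (boolP (k \in I)) => kI; last first.
  have -> : rowmask (AK K) I = rowmask (AK (K :\ k)) I.
    apply/matrixP => i j; rewrite !mxE !inE; case: ifP => // iI.
    by case: (eqVneq i k) => // E; move: kI; rewrite -E iI.
  have [H1 H2] := IH (K :\ k) I cK'; split => // IK; apply: H2.
  by rewrite subsetD1 IK.
have -> : \det (rowmask (AK K) I) = 1 * \det (rowmask (AK (K :\ k)) I) +
    d k * \det (rowmask (AK (K :\ k)) (I :\ k)).
  apply: (@determinant_multilinear _ _ _ _ _ k).
  - apply/rowP => j; rewrite !mxE !inE kI kK eqxx /= mulr0n mulr1n mul0rn addr0 mul1r.
    by rewrite mulr_natr.
  - apply/matrixP => i j; rewrite !mxE !inE.
    by rewrite [lift k i == k]eq_sym (negbTE (neq_lift _ _)).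
  - apply/matrixP => i j; rewrite !mxE !inE.
    by rewrite [lift k i == k]eq_sym (negbTE (neq_lift _ _)).
have [H1 _] := IH (K :\ k) I cK'.
have [H2 H3] := IH (K :\ k) (I :\ k) cK'.
rewrite mul1r; split; first by rewrite addr_ge0 // mulr_ge0 // ltW.
by move=> IK; rewrite ltr_wpDl // mulr_gt0 // H3 // finset.setSD.
Qed.

(** On the set S where x is negative, the inequality (A + e) x >= 0 survives
    the removal of the other coordinates, since the entries of A discarded are
    nonpositive. Increasing the diagonal on S then turns it into an equality,
    which contradicts the positivity of the minors. *)
Lemma Z_inverse_positive n (A : 'M[R]_n) (e : R) (x : 'cV[R]_n) :
  (forall i j, i != j -> A i j <= 0) -> (forall I, 0 <= \det (rowmask A I)) ->
  0 < e -> lemx 0 ((A + e%:M) *m x) -> lemx 0 x.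
Proof.
move=> offA A0 e0 Ax.
pose S := [set i | x i 0 < 0].
pose y i := \sum_(j in S) A i j * x j 0 + e * x i 0.
have y0 i : i \in S -> 0 <= y i.
  move=> iS; have := Ax i 0; rewrite mulmxDl mul_scalar_mx !mxE.
  rewrite (bigID (fun j => j \in S)) /= => H; apply: le_trans H _.
  rewrite /y lerD2r gerDl; apply: sumr_le0 => j jS.
  apply: mulr_le0_ge0; first by apply: offA; apply: contraNneq jS => <-.
  by move: jS; rewrite inE -leNgt.
pose d i := if i \in S then e - y i / x i 0 else 1.
have d0 i : 0 < d i.
  rewrite /d; case: ifP => // iS; rewrite ltr_wpDr //.
  rewrite oppr_ge0; apply: mulr_ge0_le0; first exact: y0.
  by move: iS; rewrite inE invr_le0 => /ltW.
pose z : 'cV[R]_n := \col_i (x i 0 *+ (i \in S)).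
pose M := rowmask (A + diag_mx (\row_i d i)) S.
have Mz : M *m z = 0.
  apply/colP => i; rewrite !mxE; case: (boolP (i \in S)) => iS; last first.
    rewrite (bigD1 i) //= big1 => [|j /negbTE ij].
      by rewrite !mxE (negbTE iS) mulr0n mulr0 addr0.
    by rewrite !mxE (negbTE iS) eq_sym ij mul0r.
  transitivity (\sum_(j in S) A i j * x j 0 + d i * x i 0).
    rewrite (bigID (fun j => j \in S)) /= [X in _ + X]big1 => [|j jS]; last first.
      by rewrite !mxE (negbTE jS) mulr0n mulr0.
    rewrite addr0.
    under eq_bigr => j jS do rewrite !mxE iS jS mulr1n mulrDl.
    rewrite big_split /=; congr (_ + _).
    rewrite (bigD1 i) //= eqxx mulr1n big1 ?addr0 // => j /andP[_ /negbTE ij].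
    by rewrite eq_sym ij mulr0n mul0r.
  rewrite /d iS mulrBl divfK; last by move: iS; rewrite inE => /lt_eqF ->.
  by rewrite /y; ring.
have uM : M \in unitmx by rewrite unitmxE unitfE gt_eqF // det_rowmask_gt0.
have z0 : z = 0 by rewrite -[z](mulKmx uM) Mz mulmx0.
move=> i j; rewrite ord1 mxE leNgt; apply/negP => xi.
by have := congr1 (fun v : 'cV[R]_n => v i 0) z0; rewrite !mxE inE xi => /eqP; rewrite lt_eqF.
Qed.

End PrincipalMinors.

(** * Growth of the powers attached to an M-matrix *)

Section PowerBounds.
Context {R : realType}.

(** By Bernoulli's inequality the powers of a / b are unbounded if b < a. *)
Lemma le_of_geometric (a b K : R) :
  0 < b -> (forall j, a ^+ j <= K * b ^+ j) -> a <= b.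
Proof.
move=> b0 H; rewrite leNgt; apply/negP => ab.
pose x := a / b - 1.
have x0 : 0 < x by rewrite subr_gt0 ltr_pdivlMr // mul1r.
have B j : 1 + j%:R * x <= (1 + x) ^+ j.
  elim: j => [|j IH]; first by rewrite mul0r addr0 expr0.
  rewrite exprS; apply: le_trans (_ : (1 + x) * (1 + j%:R * x) <= _).
    have : 0 <= j%:R * x * x by rewrite !mulr_ge0 // ltW.
    by rewrite -natr1; nra.
  by rewrite ler_pM2l // addr_gt0.
have HK j : 1 + j%:R * x <= K.
  apply: le_trans (B j) _; rewrite subrKC expr_div_n ler_pdivrMr ?exprn_gt0 //.
have [j Hj] : exists j : nat, K / x < j%:R.
  by exists (Num.bound `|K / x|); exact: le_lt_trans (ler_norm _) (archi_boundP (normr_ge0 _)).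
by have := HK j; move: Hj; rewrite ltr_pdivrMr //; lra.
Qed.

(** For an entrywise nonnegative B this says that the spectral radius of B is
    less than t. *)
Definition rho_lt n (B : 'M[R]_n) (t : R) :=
  exists K r, [/\ 0 <= K, 0 <= r, r < t & forall k i j, (B ^+ k) i j <= K * r ^+ k].

Lemma rho_lt_gt0 n (B : 'M[R]_n) t : rho_lt B t -> 0 < t.
Proof. by case=> K [r [_ r0 rt _]]; exact: le_lt_trans rt. Qed.

(** If y > 0 and B y <= r y then B^k y <= r^k y, which bounds the entries of
    B^k. Here B y = t y - 1, so that r = t - 1 / kappa works as soon as
    every y i is at most kappa. *)
Lemma rho_lt_supersolution n (B : 'M[R]_n) t (y : 'cV[R]_n) :
  lemx 0 B -> 0 < t -> lemx 0 y -> (t%:M - B) *m y = const_mx 1 -> rho_lt B t.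
Proof.
move=> B0 t0 y0 Hy.
have y0' i : 0 <= y i 0 by have := y0 i 0; rewrite mxE.
have By i : (B *m y) i 0 = t * y i 0 - 1.
  have := congr1 (fun v : 'cV[R]_n => v i 0) Hy.
  by rewrite /= mulmxBl mul_scalar_mx !mxE; lra.
pose kappa := 1 + \sum_i y i 0.
have k0 : 0 < kappa by rewrite ltr_pwDl // sumr_ge0.
have yk i : y i 0 <= kappa.
  rewrite /kappa (bigD1 i) //=.
  have : 0 <= \sum_(j | j != i) y j 0 by apply: sumr_ge0.
  lra.
pose r := Num.max 0 (t - kappa^-1).
have r0 : 0 <= r by rewrite le_max lexx.
have Byr i : (B *m y) i 0 <= r * y i 0.
  rewrite By; apply: le_trans (_ : (t - kappa^-1) * y i 0 <= _).
    rewrite mulrBl lerD2l lerN2 ler_pdivrMl ?mulr1 //.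
  by apply: ler_wpM2r => //; rewrite le_max lexx orbT.
have Bk k i : (B ^+ k *m y) i 0 <= r ^+ k * y i 0.
  elim: k i => [|k IH] i; first by rewrite !expr0 mul1mx mul1r.
  rewrite exprSr -mulmxE -mulmxA; apply: le_trans (_ : (B ^+ k *m (r *: y)) i 0 <= _).
    apply: (lemx_mul (expmx_ge0 k B0)) => //; first exact: mulmx_ge0.
    by move=> a b; rewrite ord1 [X in _ <= X]mxE.
  rewrite -scalemxAr mxE exprS -mulrA; exact: ler_wpM2l.
have ylb i : t^-1 <= y i 0.
  have : 0 <= (B *m y) i 0 by have := mulmx_ge0 B0 y0 i 0; rewrite mxE.
  by rewrite By subr_ge0 => H; rewrite -[t^-1]mul1r ler_pdivrMr // mulrC.
exists (t * kappa), r; split => //; first by rewrite mulr_ge0 // ltW.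
  by rewrite /r gt_max t0 gtrBl invr_gt0.
move=> k i j; rewrite -mulrA mulrC -ler_pdivrMr //.
apply: le_trans (_ : (B ^+ k *m y) i 0 <= _); last first.
  by apply: le_trans (Bk k i) _; rewrite mulrC ler_wpM2r ?exprn_ge0.
have Bk0 a b : 0 <= (B ^+ k) a b by have := expmx_ge0 k B0 a b; rewrite mxE.
rewrite mxE (bigD1 j) //= -[X in X <= _]addr0 lerD //.
  exact: ler_wpM2l.
by apply: sumr_ge0 => l _; rewrite mulr_ge0.
Qed.

(** The diagonal entry b of B^k satisfies b^j <= (B^(k j)) i i for all j, so it
    cannot exceed t^k when the entries of B^(k j) are O(t^(k j)). *)
Lemma diag_exp_le n (B : 'M[R]_n) t k i :
  lemx 0 B -> rho_lt B t -> (B ^+ k) i i <= t ^+ k.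
Proof.
move=> B0 rB; have t0 := rho_lt_gt0 rB; case: rB => K [r [K0 r0 rt HK]].
have Bk0 l a b : 0 <= (B ^+ l) a b by have := expmx_ge0 l B0 a b; rewrite mxE.
have sup j : (B ^+ k) i i ^+ j <= (B ^+ (k * j)) i i.
  elim: j => [|j IH]; first by rewrite muln0 !expr0 mxE eqxx.
  rewrite mulnS exprD exprS -mulmxE mxE (bigD1 i) //= -[X in X <= _]addr0 lerD //.
    by apply: ler_wpM2l.
  by apply: sumr_ge0 => l _; rewrite mulr_ge0.
apply: (@le_of_geometric _ _ K) => [|j]; first exact: exprn_gt0.
apply: le_trans (sup j) _; apply: le_trans (HK _ _ _) _.
apply: ler_wpM2l => //; rewrite -exprM; apply: lerXn2r; rewrite ?nnegrE //; exact: ltW.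
Qed.

Lemma trace_exp_ge0 n (B : 'M[R]_n) k : lemx 0 B -> 0 <= \tr (B ^+ k).
Proof.
by move=> B0; apply: sumr_ge0 => i _; have := expmx_ge0 k B0 i i; rewrite mxE.
Qed.

Lemma trace_exp_le n (B : 'M[R]_n) K r :
  (forall k i j, (B ^+ k) i j <= K * r ^+ k) ->
  forall k, \tr (B ^+ k) <= n%:R * K * r ^+ k.
Proof.
move=> HK k; apply: le_trans (_ : \sum_(i < n) K * r ^+ k <= _).
  exact: ler_sum.
by rewrite sumr_const card_ord -mulrA mulr_natl.
Qed.

Lemma left_eigen_exp n (B : 'M[R]_n) (l : R) (v : 'rV[R]_n) k :
  v *m B = l *: v -> v *m B ^+ k = l ^+ k *: v.
Proof.
move=> vB; elim: k => [|k IH]; first by rewrite !expr0 mulmx1 scale1r.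
by rewrite exprSr -mulmxE mulmxA IH -scalemxAl vB scalerA exprSr.
Qed.

(** A left kernel vector v of t - B satisfies v B^k = t^k v, and the entries of
    v B^k are O(r^k) with r < t. *)
Lemma rho_lt_unitmx n (B : 'M[R]_n) t : lemx 0 B -> rho_lt B t -> t%:M - B \in unitmx.
Proof.
move=> B0 rB; have t0 := rho_lt_gt0 rB; case: rB => K [r [K0 r0 rt HK]].
rewrite unitmxE unitfE; apply/negP => /det0P[v v0 vtB].
have vB : v *m B = t *: v.
  by move: vtB; rewrite mulmxBr mul_mx_scalar => /eqP; rewrite subr_eq0 => /eqP.
have [j vj] : exists j, v 0 j != 0.
  apply/existsP; apply: contra_neqT v0; rewrite negb_exists => /forallP v0.
  by apply/rowP => j; rewrite mxE; apply/eqP; rewrite -[_ == _]negbK.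
have vj0 : 0 < `|v 0 j| by rewrite normr_gt0.
pose r' := (r + t) / 2.
have r't : r' < t by rewrite /r'; lra.
suff : t <= r' by rewrite leNgt r't.
apply: (@le_of_geometric _ _ ((\sum_i `|v 0 i|) * K / `|v 0 j|)) => [|k].
  by rewrite /r'; lra.
rewrite mulrAC ler_pdivlMr // -[X in X * _](ger0_norm (exprn_ge0 k (ltW t0))) -normrM.
have -> : t ^+ k * v 0 j = (v *m B ^+ k) 0 j by rewrite (left_eigen_exp k vB) mxE.
rewrite mxE; apply: le_trans (ler_norm_sum _ _ _) _.
rewrite -mulrA mulr_suml; apply: ler_sum => i _; rewrite normrM.
apply: ler_wpM2l => //.
have Bk0 : 0 <= (B ^+ k) i j by have := expmx_ge0 k B0 i j; rewrite mxE.
rewrite ger0_norm //; apply: le_trans (HK k i j) _; apply: ler_wpM2l => //.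
by apply: lerXn2r; rewrite ?nnegrE // /r'; lra.
Qed.

(** Passing to a submatrix discards nonnegative terms of the sums giving the
    entries of B^k. *)
Lemma rho_lt_mxsub n (B : 'M[R]_n) k (f : 'I_k -> 'I_n) t : injective f ->
  lemx 0 B -> rho_lt B t -> rho_lt (mxsub f f B) t.
Proof.
move=> finj B0 [K [r [K0 r0 rt HK]]]; exists K, r; split => // l i j.
apply: le_trans (HK l (f i) (f j)).
have Bk0 q a b : 0 <= (B ^+ q) a b by have := expmx_ge0 q B0 a b; rewrite mxE.
elim: l i j => [|l IH] i j; first by rewrite !expr0 !mxE (inj_eq finj).
rewrite !exprS -!mulmxE !mxE.
apply: le_trans (_ : \sum_(q < k) B (f i) (f q) * (B ^+ l) (f q) (f j) <= _).
  apply: ler_sum => q _; rewrite mxE; apply: ler_wpM2l => //.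
  by have := B0 (f i) (f q); rewrite mxE.
rewrite -(big_imset (fun a => B (f i) a * (B ^+ l) a (f j))) /=; last by move=> a b _ _ /finj.
rewrite [X in _ <= X](bigID (fun a => a \in f @: [pred q | true])) /=.
rewrite -[X in X <= _]addr0 lerD //.
by apply: sumr_ge0 => a _; rewrite mulr_ge0 //; have := B0 (f i) a; rewrite mxE.
Qed.

Lemma exp_addscalar n (B : 'M[R]_n) x k :
  (x%:M + B) ^+ k = \sum_(i < k.+1) ((x ^+ (k - i) *+ 'C(k, i)) *: B ^+ i).
Proof.
rewrite exprDn_comm; last by rewrite /GRing.comm -!mulmxE scalar_mxC.
apply: eq_bigr => i _; rewrite -scalerMnl; congr (_ *+ _).
have -> : (x%:M : 'M[R]_n) ^+ (k - i) = (x ^+ (k - i))%:M.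
  elim: (k - i)%N => [|l IH]; first by rewrite !expr0.
  by rewrite !exprS IH -mulmxE -scalar_mxM.
by rewrite -mulmxE mul_scalar_mx.
Qed.

(** The binomial expansion of (x + B)^k has nonnegative coefficients. *)
Lemma exp_addscalar_le n (B : 'M[R]_n) K r x : 0 <= x ->
  (forall k i j, (B ^+ k) i j <= K * r ^+ k) ->
  forall k i j, ((x%:M + B) ^+ k) i j <= K * (x + r) ^+ k.
Proof.
move=> x0 HK k i j; rewrite exp_addscalar summxE exprDn mulr_sumr.
apply: ler_sum => l _; rewrite mxE -mulrnAl.
rewrite mulrCA; apply: ler_wpM2l => //.
by rewrite mulrn_wge0 // exprn_ge0.
Qed.

End PowerBounds.

Section MMatrices.
Context {R : realType}.

Lemma M_matrix_rowmask n (A : 'M[R]_n) : M_matrix A ->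
  forall K, 0 <= \det (rowmask A K).
Proof.
move=> [_ A0] K; have := A0 K; rewrite /principal_submx.
rewrite (det_mxsub_rowmask _ enum_val_inj).
suff -> : [set (enum_val : 'I_#|K| -> _) i | i in [set: 'I_#|K|]] = K by [].
apply/setP => i; apply/imsetP/idP => [[j _ ->]|iK]; first exact: enum_valP.
by exists (enum_rank_in iK i); rewrite ?inE ?enum_rankK_in.
Qed.

Lemma M_matrix_principal n (A : 'M[R]_n) (I : {set 'I_n}) :
  M_matrix A -> M_matrix (principal_submx A I).
Proof.
move=> hA; split => [i j ij|K].
  by rewrite mxE; apply: (proj1 hA); rewrite (inj_eq enum_val_inj).
have -> : principal_submx (principal_submx A I) K =
    mxsub (enum_val \o (enum_val : 'I_#|K| -> _)) (enum_val \o (enum_val : 'I_#|K| -> _)) A.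
  by apply/matrixP => i j; rewrite !mxE.
rewrite det_mxsub_rowmask; first exact: M_matrix_rowmask.
by apply: inj_comp; exact: enum_val_inj.
Qed.

Lemma split_scalar_ge0 n (A : 'M[R]_n) : 0 <= split_scalar A.
Proof. exact: bigmax_ge_id. Qed.

Lemma split_scalar_principal n (A : 'M[R]_n) (I : {set 'I_n}) :
  split_scalar (principal_submx A I) <= split_scalar A.
Proof.
rewrite /split_scalar; apply: bigmax_le; first exact: split_scalar_ge0.
by move=> i _; rewrite mxE (bigD1 (enum_val i)) //= le_max lexx.
Qed.

Lemma split_rest_lemx n (A : 'M[R]_n) : M_matrix A -> lemx 0 (split_rest A).
Proof. by move=> hA i j; rewrite mxE; exact: split_rest_ge0. Qed.

(** The determinant of A + e is a minor of A with the whole diagonal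
    increased by e. *)
Lemma M_matrix_shift_unit n (A : 'M[R]_n) e : M_matrix A -> 0 < e ->
  A + e%:M \in unitmx.
Proof.
move=> hA e0; rewrite unitmxE unitfE.
have := det_rowmask_gt0 (M_matrix_rowmask hA) (fun=> e0) [set: 'I_n].
have -> : rowmask (A + diag_mx (\row__ e)) [set: 'I_n] = A + e%:M.
  by apply/matrixP => i j; rewrite !mxE inE.
by move=> /gt_eqF ->.
Qed.

Lemma M_matrix_rho_lt n (A : 'M[R]_n) t : M_matrix A -> split_scalar A < t ->
  rho_lt (split_rest A) t.
Proof.
move=> hA st; pose e := t - split_scalar A.
have e0 : 0 < e by rewrite subr_gt0.
have uA := M_matrix_shift_unit hA e0.
apply: (@rho_lt_supersolution _ _ _ _ (invmx (A + e%:M) *m const_mx 1)).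
- exact: split_rest_lemx.
- exact: le_lt_trans (split_scalar_ge0 A) st.
- apply: (Z_inverse_positive (proj1 hA) (M_matrix_rowmask hA) e0).
  by rewrite mulKVmx // => i j; rewrite !mxE ler01.
have -> : t%:M - split_rest A = A + e%:M.
  by apply/matrixP => i j; rewrite !mxE; case: (i == j); rewrite /= ?mulr1n ?mulr0n /e; lra.
by rewrite mulKVmx.
Qed.

(** The vectors y e = (A + e)^-1 1 are nonnegative and stay bounded as e tends
    to 0, hence so is their limit A^-1 1. *)
Lemma M_matrix_inv_ge0 n (A : 'M[R]_n) : M_matrix A -> A \in unitmx ->
  lemx 0 (invmx A *m (const_mx 1 : 'cV[R]_n)).
Proof.
move=> hA uA; set x := invmx A *m _.
pose nx := \sum_i `|x i 0|.
pose kap := \sum_i \sum_j `|invmx A i j|.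
have kap0 : 0 <= kap by apply: sumr_ge0 => i _; apply: sumr_ge0.
have nx0 : 0 <= nx by apply: sumr_ge0.
suff H e : 0 < e -> e * kap <= 1 / 2 -> forall i, - (e * kap * (2 * nx)) <= x i 0.
  move=> i j; rewrite ord1 mxE; apply/ler_addgt0Pr => z z0.
  (* Small enough for e * kap <= 1 / 2 and for the lower bound to exceed - z. *)
  pose e := Num.min ((2 * (1 + kap))^-1) (z / (1 + kap * (2 * nx))).
  have c1 : 0 < 2 * (1 + kap) by rewrite mulr_gt0 // ltr_pwDl.
  have c2 : 0 < 1 + kap * (2 * nx) by rewrite ltr_pwDl // !mulr_ge0.
  have e0 : 0 < e by rewrite lt_min invr_gt0 c1 divr_gt0.
  have e1 : e <= (2 * (1 + kap))^-1 by rewrite ge_min lexx.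
  have e2 : e <= z / (1 + kap * (2 * nx)) by rewrite ge_min lexx orbT.
  have {}e1 : e * (2 * (1 + kap)) <= 1 by rewrite -ler_pdivlMr // mul1r.
  have {}e2 : e * (1 + kap * (2 * nx)) <= z by rewrite -ler_pdivlMr.
  have ke : 0 <= e * kap by rewrite mulr_ge0 // ltW.
  have := H e e0 _ i; have -> : e * kap <= 1 / 2 by lra.
  by move=> /(_ isT); lra.
move=> e0 ek.
have uAe := M_matrix_shift_unit hA e0.
pose y := invmx (A + e%:M) *m (const_mx 1 : 'cV[R]_n).
have y0 i : 0 <= y i 0.
  have := @Z_inverse_positive _ _ A e y (proj1 hA) (M_matrix_rowmask hA) e0.
  rewrite mulKVmx // => /(_ _ i 0); rewrite mxE; apply => a b.
  by rewrite !mxE ler01.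
have xy : x = y + e *: (invmx A *m y).
  apply: (can_inj (mulKmx uA)); rewrite /x mulKVmx // mulmxDr -scalemxAr mulKVmx //.
  by rewrite -mul_scalar_mx -mulmxDl /y mulKVmx.
have ny : \sum_i y i 0 <= 2 * nx.
  have H1 : \sum_i y i 0 <= nx + e * kap * \sum_i y i 0.
    have S i : y i 0 <= `|x i 0| + e * (\sum_j `|invmx A i j|) * \sum_j y j 0.
      have -> : y i 0 = x i 0 - e * (invmx A *m y) i 0 by rewrite xy !mxE addrK.
      rewrite lerD ?ler_norm // -mulrN -mulrA ler_pM2l //.
      apply: le_trans (ler_norm _) _; rewrite normrN mxE.
      apply: le_trans (ler_norm_sum _ _ _) _; rewrite mulr_suml.
      apply: ler_sum => j _; rewrite normrM ler_wpM2l // ger0_norm //.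
      by rewrite (bigD1 j) //= lerDl sumr_ge0.
    apply: le_trans (ler_sum _ (fun i _ => S i)) _.
    by rewrite big_split /= lerD2l -mulr_suml -mulr_sumr.
  have : e * kap * \sum_i y i 0 <= 1 / 2 * \sum_i y i 0.
    by apply: ler_wpM2r => //; apply: sumr_ge0.
  by move: H1; set Y := \sum_i y i 0; lra.
move=> i; rewrite xy mxE [X in _ <= _ + X]mxE.
apply: le_trans (_ : e * (invmx A *m y) i 0 <= _); last by rewrite lerDr.
rewrite lerNl -mulrN -mulrA ler_pM2l //.
apply: le_trans (ler_norm _) _; rewrite normrN mxE.
apply: le_trans (ler_norm_sum _ _ _) _.
apply: le_trans (_ : kap * \sum_i y i 0 <= _); last exact: ler_wpM2l.
apply: le_trans (_ : (\sum_j `|invmx A i j|) * \sum_i y i 0 <= _); last first.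
  apply: ler_wpM2r; first exact: sumr_ge0.
  rewrite /kap [X in _ <= X](bigD1 i) //= lerDl; apply: sumr_ge0 => a _; exact: sumr_ge0.
rewrite mulr_suml; apply: ler_sum => j _; rewrite normrM ler_wpM2l // ger0_norm //.
by rewrite (bigD1 j) //= lerDl sumr_ge0.
Qed.

(** The vector A^-1 1 is nonnegative and plays the part of y in the
    supersolution argument. *)
Lemma M_matrix_unit_rho_lt n (A : 'M[R]_n) : M_matrix A -> A \in unitmx ->
  (0 < n)%N -> rho_lt (split_rest A) (split_scalar A).
Proof.
move=> hA uA n0; have x0 := M_matrix_inv_ge0 hA uA.
have B0 := split_rest_lemx hA.
have E : ((split_scalar A)%:M - split_rest A) *m (invmx A *m const_mx 1) = const_mx 1 :> 'cV_n.
  by rewrite -split_scalarK mulKVmx.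
apply: (rho_lt_supersolution B0 _ x0 E).
rewrite lt_def split_scalar_ge0 andbT; apply/eqP => s0.
have := congr1 (fun v : 'cV[R]_n => v (Ordinal n0) 0) E.
rewrite s0 mulmxBl mul_scalar_mx scale0r add0r [X in _ = X]mxE [X in X = _]mxE.
have := mulmx_ge0 B0 x0 (Ordinal n0) 0; rewrite mxE; lra.
Qed.

End MMatrices.

(** * Taylor families *)

Section TaylorFamilies.
Local Open Scope classical_set_scope.
Local Open Scope ring_scope.
Context {R : realType}.
Implicit Types (phi b : nat -> R -> R) (x u : nat -> R) (c d s t y l r K : R).

(** The functions phi i t = (-1)^i f^(i)(t) / i!, where f = phi 0, for which
    f (t - x) is the sum of the phi i t x^i. *)
Definition taylor_family phi := forall (i : nat) (t : R), 0 < t ->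
  is_derive t 1 (phi i) (- (i.+1%:R * phi i.+1 t)).

(** The properties of b k t = (t - c)^k, or of the trace of (t - C)^k, that
    enter the Taylor formula. *)
Definition appell b := (forall t : R, is_derive t 1 (b 0%N) 0) /\
  (forall (k : nat) (t : R), is_derive t 1 (b k.+1) (k.+1%:R * b k t)).

Lemma MVT_gt0 (f df : R -> R) c t :
  (forall y, 0 < y -> is_derive y 1 f (df y)) -> 0 < c -> c <= t ->
  exists2 y, c <= y <= t & f t - f c = df y * (t - c).
Proof.
move=> fd c0 ct.
have [y yct H] : exists2 y, y \in `[c, t] & f t - f c = df y * (t - c).
  apply: MVT_segment => // [y|].
    by rewrite in_itv /= => /andP[cy _]; apply: fd; exact: lt_trans cy.
  apply: derivable_within_continuous => y; rewrite in_itv /= => /andP[cy _].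
  have [] // := fd y; exact: lt_le_trans cy.
by exists y => //; move: yct; rewrite in_itv.
Qed.

(** All the terms of the derivative cancel in pairs except the last one: this
    is the identity behind Taylor's formula, and behind the independence of the
    series from its centre. *)
Lemma taylor_sum_derive phi b t N : taylor_family phi -> appell b -> 0 < t ->
  is_derive t 1 (fun y => \sum_(i < N.+1) phi i y * b i y)
    (- (N.+1%:R * phi N.+1 t * b N t)).
Proof.
move=> tphi [b0 bS] t0; elim: N => [|N IH].
  have -> : (fun y => \sum_(i < 1) phi i y * b i y) = phi 0%N * b 0%N.
    by apply/funext => y; rewrite big_ord1.
  by apply: is_derive_eq (is_deriveM (tphi 0%N t t0) (b0 t)) _; rewrite /GRing.scale /=; ring.
have -> : (fun y => \sum_(i < N.+2) phi i y * b i y) =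
    (fun y => \sum_(i < N.+1) phi i y * b i y) + phi N.+1 * b N.+1.
  by apply/funext => y; rewrite big_ord_recr.
apply: is_derive_eq (is_deriveD IH (is_deriveM (tphi N.+1 t t0) (bS N t))) _.
by rewrite /GRing.scale /=; ring.
Qed.

Lemma appell_power (c : R) : appell (fun i y => (y - c) ^+ i).
Proof.
have E k y : is_derive y 1 (fun y : R => (y - c) ^+ k) (k%:R * (y - c) ^+ k.-1).
  have -> : (fun y : R => (y - c) ^+ k) = horner (('X - c%:P) ^+ k).
    by apply/funext => z; rewrite !hornerE.
  apply: is_derive_eq (is_derive_poly _ _) _.
  by rewrite deriv_exp derivXsubC mul1r hornerMn !hornerE mulr_natl.
by split => [t|k t]; [have := E 0%N t; rewrite mul0r|exact: E].
Qed.

(** The left-hand side is nonincreasing in t, since its derivative is reduced to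
    the remainder, and at t = c it equals phi 0 c. *)
Lemma taylor_sum_le phi N c t : taylor_family phi ->
  (forall y, 0 < y -> 0 <= phi N.+1 y) -> 0 < c -> c <= t ->
  \sum_(i < N.+1) phi i t * (t - c) ^+ i <= phi 0%N c.
Proof.
move=> tphi phi0 c0 ct.
have [y /andP[cy yt]] := MVT_gt0 (fun y => taylor_sum_derive N tphi (appell_power c)) c0 ct.
have -> : \sum_(i < N.+1) phi i c * (c - c) ^+ i = phi 0%N c.
  by rewrite big_ord_recl big1 => [|i _]; rewrite subrr ?expr0 ?mulr1 ?addr0 ?expr0n ?mulr0.
move/eqP; rewrite subr_eq => /eqP ->; rewrite gerDr mulNr oppr_le0.
rewrite !mulr_ge0 ?exprn_ge0 ?subr_ge0 //; apply: phi0; exact: lt_le_trans cy.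
Qed.

(** The sign condition says that f'' is completely monotone. *)
Definition pos_taylor_family phi :=
  taylor_family phi /\ forall i t, 0 < t -> 0 <= phi i.+2 t.

(** The Taylor family of f''. When f'' is completely monotone its coefficients
    are all nonnegative, so that Taylor's bound involves no term of unknown
    sign. *)
Lemma second_taylor_family phi : taylor_family phi ->
  taylor_family (fun i t => i.+1%:R * i.+2%:R * phi i.+2 t).
Proof.
move=> tphi i t t0.
have -> : (fun t => i.+1%:R * i.+2%:R * phi i.+2 t) = (i.+1%:R * i.+2%:R : R) \*: phi i.+2.
  by apply/funext.
apply: is_derive_eq (is_deriveZ _ (tphi i.+2 t t0)) _.
by rewrite /GRing.scale /=; ring.
Qed.

Section PosTaylor.
Variables (phi : nat -> R -> R) (pphi : pos_taylor_family phi).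

Lemma second_taylor_sum_le c t N : 0 < c -> c <= t ->
  \sum_(i < N) i.+1%:R * i.+2%:R * phi i.+2 t * (t - c) ^+ i <= 2 * phi 2%N c.
Proof.
move=> c0 ct; have p0 i y : 0 < y -> 0 <= i.+1%:R * i.+2%:R * phi i.+2 y.
  by move=> y0; rewrite !mulr_ge0 //; exact: (proj2 pphi).
case: N => [|N]; first by rewrite big_ord0 mulr_ge0 // (proj2 pphi).
have := taylor_sum_le (N := N) (second_taylor_family (proj1 pphi)) (p0 _) c0 ct.
by rewrite mul1r.
Qed.

Lemma second_taylor_coef_le c t N : 0 < c -> c <= t ->
  N.+1%:R * N.+2%:R * phi N.+2 t * (t - c) ^+ N <= 2 * phi 2%N c.
Proof.
move=> c0 ct; apply: le_trans (second_taylor_sum_le N.+1 c0 ct).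
rewrite big_ord_recr /= lerDr; apply: sumr_ge0 => i _.
by rewrite !mulr_ge0 ?exprn_ge0 ?subr_ge0 // (proj2 pphi) // (lt_le_trans c0).
Qed.

Lemma pos_taylor_nonincreasing i s t : 0 < s -> s <= t -> phi i.+2 t <= phi i.+2 s.
Proof.
move=> s0 st; have [y /andP[sy _]] := MVT_gt0 ((proj1 pphi) i.+2) s0 st.
move/eqP; rewrite subr_eq => /eqP ->; rewrite gerDr mulNr oppr_le0.
by rewrite !mulr_ge0 ?subr_ge0 // (proj2 pphi) // (lt_le_trans s0).
Qed.

Definition tail_bounded u := exists M, forall N, \sum_(i < N) u i.+2 <= M.

Lemma tail_series_shift u N : series u (N + 2)%N = u 0%N + u 1%N + \sum_(i < N) u i.+2.
Proof.
rewrite /series /= big_mkord addn2 !big_ord_recl addrA.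
by under eq_bigr do rewrite ?lift0.
Qed.

Lemma tail_nondecreasing u : (forall i, 0 <= u i.+2) ->
  nondecreasing_seq (fun N => series u (N + 2)%N).
Proof.
move=> u0; apply/nondecreasing_seqP => N; rewrite !tail_series_shift lerD2l.
by rewrite big_ord_recr /= lerDl.
Qed.

Lemma cvg_tail_bounded u : (forall i, 0 <= u i.+2) -> tail_bounded u ->
  cvgn (series u).
Proof.
move=> u0 [M HM].
have : cvgn (fun N => series u (N + 2)%N).
  apply: nondecreasing_is_cvgn; first exact: tail_nondecreasing.
  exists (u 0%N + u 1%N + M) => _ [N _ <-].
  by rewrite tail_series_shift lerD2l.
move=> cu; apply: (cvgP (limn (fun N => series u (N + 2)%N))).
by rewrite -(cvg_shiftn 2); exact: cu.
Qed.

Lemma series_le_lim u N : (forall i, 0 <= u i.+2) -> cvgn (series u) ->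
  (2 <= N)%N -> series u N <= limn (series u).
Proof.
move=> u0 cu N2; have cu' : (fun N => series u (N + 2)%N) @ \oo --> limn (series u).
  by rewrite cvg_shiftn.
have := @nondecreasing_cvgn_le _ _ (tail_nondecreasing u0).
move=> /(_ _ (N - 2)%N); rewrite subnK // (cvg_lim _ cu') //; apply.
exact: cu'.
Qed.

Lemma tail_bounded_le u v : (forall i, u i.+2 <= v i.+2) -> tail_bounded v ->
  tail_bounded u.
Proof.
move=> uv [M HM]; exists M => N; apply: le_trans (HM N); exact: ler_sum.
Qed.

(** At c = t - r the bound on the Taylor sums of f'' dominates the sum of the
    phi i t r^i. *)
Lemma tail_bounded_geometric t x K r : 0 <= r -> r < t -> 0 <= K ->
  (forall i, x i <= K * r ^+ i) -> tail_bounded (fun i => phi i t * x i).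
Proof.
move=> r0 rt K0 xK; exists (K * r ^+ 2 * (2 * phi 2%N (t - r))) => N.
have c0 : 0 < t - r by rewrite subr_gt0.
have ct : t - r <= t by rewrite gerBl.
have t0 : 0 < t by exact: le_lt_trans rt.
apply: le_trans (ler_wpM2l _ (second_taylor_sum_le N c0 ct)); last first.
  by rewrite mulr_ge0 ?exprn_ge0.
rewrite mulr_sumr; apply: ler_sum => i _.
have p0 : 0 <= phi i.+2 t by exact: (proj2 pphi).
apply: le_trans (_ : phi i.+2 t * (K * r ^+ i.+2) <= _); first exact: ler_wpM2l.
rewrite subKr -addn2 exprD.
have -> : phi (i + 2)%N t * (K * (r ^+ i * r ^+ 2)) =
  1 * (K * r ^+ 2 * (phi i.+2 t * r ^+ i)) by rewrite addn2; ring.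
have -> : K * r ^+ 2 * (i.+1%:R * (i + 2)%:R * phi (i + 2)%N t * r ^+ i) =
  (i.+1%:R * i.+2%:R) * (K * r ^+ 2 * (phi i.+2 t * r ^+ i)) by rewrite addn2; ring.
apply: ler_wpM2r; first by rewrite !mulr_ge0 ?exprn_ge0.
by rewrite -natrM ler1n muln_gt0.
Qed.

(** Letting c tend to 0 in Taylor's formula bounds the series at its radius of
    convergence by f(0+). *)
Lemma tail_bounded_at0 s x K l : phi 0%N c @[c --> 0^'+]%classic --> l -> 0 < s ->
  (forall i, x i <= K * s ^+ i) -> 0 <= K -> tail_bounded (fun i => phi i s * x i).
Proof.
move=> phil s0 xK K0.
suff [M HM] : tail_bounded (fun i => phi i s * s ^+ i).
  exists (K * M) => N; apply: le_trans (ler_wpM2l K0 (HM N)).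
  rewrite mulr_sumr; apply: ler_sum => i _.
  apply: le_trans (ler_wpM2l _ (xK i.+2)) _; first exact: (proj2 pphi).
  by rewrite mulrCA.
exists (l - (phi 0%N s + phi 1%N s * s)) => N.
rewrite lerBrDl.
have cl : (\sum_(i < N.+2) phi i s * (s - c) ^+ i) @[c --> 0^'+]%classic -->
    \sum_(i < N.+2) phi i s * s ^+ i.
  pose q := \sum_(i < N.+2) phi i s *: (s%:P - 'X) ^+ i.
  have -> : (fun c => \sum_(i < N.+2) phi i s * (s - c) ^+ i) = horner q.
    by apply/funext => c; rewrite horner_sum; apply: eq_bigr => i _; rewrite !hornerE.
  have -> : \sum_(i < N.+2) phi i s * s ^+ i = q.[0].
    by rewrite horner_sum; apply: eq_bigr => i _; rewrite !hornerE subr0.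
  apply: cvg_at_right_filter; exact: continuous_horner.
have : \sum_(i < N.+2) phi i s * s ^+ i <= l.
  apply: (ler_cvg_to cl phil); near=> c.
  apply: taylor_sum_le; [exact: (proj1 pphi)|exact: (proj2 pphi)| |].
    by near: c; exact: nbhs_right_gt.
  by near: c; exact: nbhs_right_le.
by rewrite !big_ord_recl expr0 mulr1 expr1 addrA; under eq_bigr do rewrite ?lift0.
Unshelve. all: by end_near. Qed.

(** By the mean value theorem the partial sums at s and at t differ by a
    remainder, which the Taylor bound for f'' shows to be O(1 / N). *)
Lemma taylor_series_indep b K d s t : appell b -> 0 < d -> d <= s -> s <= t ->
  0 <= K -> (forall k y, s <= y -> 0 <= b k y <= K * (y - d) ^+ k) ->
  limn (series (fun i => phi i s * b i s)) = limn (series (fun i => phi i t * b i t)).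
Proof.
move=> ab d0 ds st K0 bK; have s0 : 0 < s by exact: lt_le_trans ds.
have cv y : s <= y -> cvgn (series (fun i => phi i y * b i y)).
  move=> sy; have y0 : 0 < y by exact: lt_le_trans sy.
  apply: cvg_tail_bounded => [i|].
    by apply: mulr_ge0; [exact: (proj2 pphi)|case/andP: (bK i.+2 y sy)].
  apply: (@tail_bounded_geometric _ _ K (y - d)) => //.
  - by rewrite subr_ge0; exact: le_trans sy.
  - by rewrite gtrBl.
  - by move=> i; case/andP: (bK i y sy).
pose M := K * (2 * phi 2%N d) * t * (t - s).
have step N : `|series (fun i => phi i t * b i t) (N + 2)%N -
               series (fun i => phi i s * b i s) (N + 2)%N| <= M * harmonic N.
  rewrite /series /= !big_mkord addn2.
  have [y /andP[sy yt] ->] := MVT_gt0 (fun y => taylor_sum_derive N.+1 (proj1 pphi) ab) s0 st.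
  have y0 : 0 < y by exact: lt_le_trans sy.
  have dy : d <= y by exact: le_trans sy.
  have p0 : 0 <= phi N.+2 y by exact: (proj2 pphi).
  have [b0 bK'] := andP (bK N.+1 y sy).
  rewrite mulNr normrN ger0_norm; last by rewrite !mulr_ge0 ?subr_ge0.
  rewrite /M [X in _ <= X]mulrAC; apply: ler_wpM2r; first by rewrite subr_ge0.
  apply: le_trans (ler_wpM2l _ bK') _; first by rewrite mulr_ge0.
  (* The factor N + 1 gained on the Taylor coefficient of f'' is the decay. *)
  have -> : N.+2%:R * phi N.+2 y * (K * (y - d) ^+ N.+1) =
     K * (N.+1%:R * N.+2%:R * phi N.+2 y * (y - d) ^+ N) * (y - d) * N.+1%:R^-1.
    rewrite exprS; field; exact: lt0r_neq0.
  rewrite /harmonic /=; apply: ler_wpM2r; first by rewrite invr_ge0.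
  apply: ler_pM.
  - by rewrite !mulr_ge0 ?exprn_ge0 ?subr_ge0.
  - by rewrite subr_ge0.
  - by apply: ler_wpM2l => //; exact: second_taylor_coef_le.
  - lra.
have ss := cv s (lexx s); have tt := cv t st.
move: ss tt; set u := series _; set v := series _ => ss tt.
apply/esym/eqP; rewrite -subr_eq0; apply/eqP.
have D : (fun N => v (N + 2)%N - u (N + 2)%N) @ \oo --> limn v - limn u.
  by apply: cvgB; rewrite cvg_shiftn.
have Z : (fun N => v (N + 2)%N - u (N + 2)%N) @ \oo --> (0 : R).
  apply: norm_cvg0; apply: (@squeeze_cvgr _ _ _ _ (fun=> 0) (fun N => M * harmonic N)).
  - by near=> N; rewrite normr_ge0 step.
  - exact: cvg_cst.
  - rewrite -(mulr0 M); apply: cvgM; [exact: cvg_cst|exact: cvg_harmonic].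
exact: (cvg_unique _ D Z).
Unshelve. all: by end_near. Qed.

Lemma taylor_continuous i t : 0 < t -> {for t, continuous (phi i)}.
Proof.
by move=> t0; apply/differentiable_continuous/derivable1_diffP; have [] := proj1 pphi i t t0.
Qed.

(** The terms of index at least 2 are nonnegative and decrease in t, so the
    remainders at t > s are at most those at s. *)
Lemma taylor_series_right_cvg s x : 0 < s -> (forall i, 0 <= x i) ->
  tail_bounded (fun i => phi i s * x i) ->
  limn (series (fun i => phi i t * x i)) @[t --> s^'+]%classic -->
    limn (series (fun i => phi i s * x i)).
Proof.
move=> s0 x0 bs.
pose u t : nat -> R := fun i => phi i t * x i.
have u0 t i : s <= t -> 0 <= u t i.+2.
  by move=> st; rewrite mulr_ge0 // (proj2 pphi) // (lt_le_trans s0).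
have us t i : s <= t -> u t i.+2 <= u s i.+2.
  by move=> st; rewrite ler_wpM2r // pos_taylor_nonincreasing.
have cu t : s <= t -> cvgn (series (u t)).
  move=> st; apply: cvg_tail_bounded => [i|]; first exact: u0.
  by apply: tail_bounded_le bs => i; exact: us.
apply/cvgrPdist_le => e e0.
have [N [N2 HN]] : exists N : nat, (2 <= N)%N /\ limn (series (u s)) - series (u s) N <= e / 2.
  have /cvgrPdist_le /(_ (e / 2)) := cu s (lexx s).
  have e20 : 0 < e / 2 by rewrite divr_gt0.
  move=> /(_ e20) [N _ HN]; exists (N + 2)%N; split; first by rewrite addn2.
  by apply: le_trans (ler_norm _) _; apply: HN; rewrite /= leq_addr.
have cN : series (u t) N @[t --> s^'+]%classic --> series (u s) N.
  rewrite /series /=; apply: cvg_at_right_filter.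
  apply: (@cvg_big _ _ _ 0 _ _ _ _ _ (fun i t => u t i)) => [|i _].
    exact: add_continuous.
  by apply: cvgMr_tmp; exact: taylor_continuous.
have e20 : 0 < e / 2 by rewrite divr_gt0.
have /cvgrPdist_le /(_ _ e20) cN' := cN.
near=> t.
have st : s <= t by near: t; exact: nbhs_right_ge.
have near1 : `|series (u s) N - series (u t) N| <= e / 2 by near: t.
have lo : series (u t) N <= limn (series (u t)).
  by apply: series_le_lim => //; [move=> i; exact: u0|exact: cu].
have hi : limn (series (u t)) <= limn (series (u s)) - series (u s) N + series (u t) N.
  apply: limr_le; first exact: cu.
  exists N => // M /= NM.
  apply: le_trans (_ : series (u s) M - series (u s) N + series (u t) N <= _).
    rewrite -lerBlDr !sub_series NM; rewrite !big_nat; apply: ler_sum => i /andP[Ni _].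
    case: i Ni => [|[|i]] Ni; [by move: (leq_trans N2 Ni)|by move: (leq_trans N2 Ni)|].
    exact: us.
  rewrite lerD2r lerB //; apply: series_le_lim => //; last by exact: leq_trans NM.
    by move=> i; exact: u0.
  exact: cu.
move: near1; rewrite ler_norml => /andP[n1 n2].
rewrite ler_norml; apply/andP; split; lra.
Unshelve. all: by end_near. Qed.

End PosTaylor.

(** The traces are polynomials in t by the binomial formula. *)
Lemma appell_trace n (C : 'M[R]_n) : appell (fun k t => \tr ((t%:M - C) ^+ k)).
Proof.
pose b i := \tr ((- C) ^+ i).
pose q k : {poly R} := \sum_(i < k.+1) (b i *+ 'C(k, i)) *: 'X ^+ (k - i).
have E k : (fun t => \tr ((t%:M - C) ^+ k)) = horner (q k).
  apply/funext => t; rewrite exp_addscalar raddf_sum horner_sum /=.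
  apply: eq_bigr => i _; rewrite mxtraceZ !hornerE /b.
  by rewrite mulrC mulrnAr mulrnAl.
split => [t|k t].
  rewrite E; apply: is_derive_eq (is_derive_poly _ _) _.
  by rewrite /q big_ord1 subnn expr0 derivZ derivC scaler0 horner0.
rewrite E; apply: is_derive_eq (is_derive_poly _ _) _.
rewrite [X in _ = _ * X](congr1 (fun f => f t) (E k)).
rewrite /q big_ord_recr /= subnn expr0 derivD derivZ derivC scaler0 addr0.
rewrite -hornerZ; congr (_.[t]); rewrite raddf_sum scaler_sumr.
apply: eq_bigr => i _; rewrite /= derivZ derivXn scalerA.
have ik : (i <= k)%N by rewrite -ltnS.
rewrite -scalerMnr scalerMnl subSn //=; congr (_ *: _).
rewrite -mulrnA mulr_natl -mulrnA; congr (_ *+ _).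
by rewrite -subSn // mulnC -mul_bin_down mulnC.
Qed.

End TaylorFamilies.

(** * Series of matrices, powers and x log x *)

Section MatrixSeries.
Local Open Scope classical_set_scope.
Local Open Scope ring_scope.
Context {R : realType}.

Lemma cvg_mx_entries {T : Type} (F : set_system T) {FF : Filter F} n
  (u : T -> 'M[R]_n) (L : 'M[R]_n) :
  (forall i j, u k i j @[k --> F] --> L i j) -> u @ F --> L.
Proof.
move=> uL; apply/cvg_ballP => e e0.
have H : \forall k \near F, forall i j, ball (L i j) e (u k i j).
  apply: filter_forall => i; apply: filter_forall => j.
  by have /cvg_ballP := uL i j; apply.
by apply: filterS H => k Hk; split.
Qed.

Lemma seriesE_mx n (M : nat -> 'M[R]_n) N i j :
  series M N i j = series (fun k => M k i j) N.
Proof. by rewrite /series /= summxE. Qed.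

Lemma cvg_mx_series n (M : nat -> 'M[R]_n) :
  (forall i j, cvgn (series (fun k => M k i j))) -> cvgn (series M).
Proof.
move=> cM; apply: (cvgP (\matrix_(i, j) limn (series (fun k => M k i j)))).
apply: cvg_mx_entries => i j; rewrite mxE.
by under eq_cvg do rewrite seriesE_mx; exact: cM.
Qed.

Lemma trace_mul_series_cvg n (W : 'M[R]_n) (M : nat -> 'M[R]_n) :
  (forall i j, cvgn (series (fun k => M k i j))) ->
  series (fun k => \tr (W *m M k)) @ \oo --> \tr (W *m limn (series M)).
Proof.
move=> /cvg_mx_series cM.
have E : series (fun k => \tr (W *m M k)) =
    (fun N => \sum_i \sum_j W i j * series M N j i).
  apply/funext => N; rewrite /series /= -raddf_sum -mulmx_sumr.
  by apply: eq_bigr => i _; rewrite mxE.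
have -> : \tr (W *m limn (series M)) = \sum_i \sum_j W i j * (limn (series M)) j i.
  by apply: eq_bigr => i _; rewrite mxE.
rewrite E; apply: (@cvg_big _ _ _ 0 _ _ _ _ _
  (fun i N => \sum_j W i j * series M N j i)) => [|i _].
  exact: add_continuous.
apply: (@cvg_big _ _ _ 0 _ _ _ _ _ (fun j N => W i j * series M N j i)) => [|j _].
  exact: add_continuous.
apply: cvgMl_tmp.
have H := @continuous_cvg _ _ _ \oo _ (series M) (fun X : 'M[R]_n => X j i) (limn (series M)).
by apply: H cM; exact: coord_continuous.

Qed.

End MatrixSeries.

Section PowerFamily.
Local Open Scope classical_set_scope.
Local Open Scope ring_scope.
Context {R : realType}.
Implicit Types (p s t sg : R).

Definition signed_binom p i : R := rbinom p i * (-1) ^+ i.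

Lemma signed_binom0 p : signed_binom p 0 = 1.
Proof. by rewrite /signed_binom /rbinom big_ord0 fact0 expr0 divr1 mulr1. Qed.

Lemma signed_binomS p i :
  signed_binom p i.+1 * i.+1%:R = signed_binom p i * (i%:R - p).
Proof.
rewrite /signed_binom /rbinom big_ord_recr /= factS natrM exprS.
have : i.+1%:R != 0 :> R by exact: lt0r_neq0.
have : (i`!)%:R != 0 :> R by rewrite pnatr_eq0 -lt0n fact_gt0.
by move=> *; field; rewrite addrC natr1; apply/andP.
Qed.

(** The Taylor family of sg * t^p. The sign sg makes the second derivative
    nonnegative: it is -1 for 0 < p < 1. *)
Definition pow_family sg p i t : R := sg * signed_binom p i * t `^ (p - i%:R).

Lemma pow_family_pos sg p : p <= 2 -> 0 <= sg * (p * (p - 1)) ->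
  pos_taylor_family (pow_family sg p).
Proof.
move=> p2 sp; split => [i t t0|i t t0].
  apply: is_derive_eq (is_deriveZ (sg * signed_binom p i) (is_derive1_powR (p - i%:R) t0)) _.
  rewrite /GRing.scale /= /pow_family.
  have -> : p - i.+1%:R = p - i%:R - 1 by rewrite -natr1; ring.
  have -> : - (i.+1%:R * (sg * signed_binom p i.+1 * t `^ (p - i%:R - 1))) =
      - (sg * (signed_binom p i.+1 * i.+1%:R)) * t `^ (p - i%:R - 1) by ring.
  by rewrite signed_binomS; ring.
rewrite /pow_family mulr_ge0 ?powR_ge0 //.
elim: i => [|i IH].
  have h1 := signed_binomS p 0; have h2 := signed_binomS p 1.
  rewrite signed_binom0 in h1; nra.
have h := signed_binomS p i.+2.
have -> : sg * signed_binom p i.+3 = sg * signed_binom p i.+2 * ((i.+2%:R - p) / i.+3%:R).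
  by rewrite -mulrA mulrA -mulrA [_ * (_ / _)]mulrA -h mulfK // pnatr_eq0.
rewrite mulr_ge0 // divr_ge0 // subr_ge0 (le_trans p2) //.
by rewrite ler_nat.
Qed.

Lemma pow_family_at0 sg p : 0 < p -> pow_family sg p 0 c @[c --> 0^'+] --> (0 : R).
Proof.
move=> p0; rewrite /pow_family subr0 -[X in _ --> X](mulr0 (sg * signed_binom p 0)).
by apply: cvgMl_tmp; exact: powR_cvg0.
Qed.

Lemma pow_familyE sg p i t : 0 < t ->
  pow_family sg p i t = sg * (t `^ p * (rbinom p i * (- t) ^- i)).
Proof.
move=> t0; rewrite /pow_family powRB; last by rewrite (gt_eqF t0) implybT.
rewrite powR_mulrn ?ltW // /signed_binom (exprNn t) invfM.
have -> : ((-1) ^+ i)^-1 = (-1) ^+ i :> R by rewrite -exprVn invrN1.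
by ring.
Qed.

End PowerFamily.

Section XLogFamily.
Local Open Scope classical_set_scope.
Local Open Scope ring_scope.
Context {R : realType}.
Implicit Types (s t : R).

(** The Taylor family of f (t) = t ln t. *)
Definition xlog_family i t : R :=
  match i with
  | 0 => t * ln t
  | 1 => - (ln t + 1)
  | j.+2 => (j.+1%:R * j.+2%:R)^-1 * t `^ (- j.+1%:R)
  end.

Lemma xlog_family_pos : pos_taylor_family xlog_family.
Proof.
split => [[|[|i]] t t0|i t t0].
- apply: is_derive_eq (is_deriveM (is_derive_id t 1) (is_derive1_ln t0)) _.
  by rewrite /GRing.scale /= mulfV ?gt_eqF //; ring.
- have -> : xlog_family 1 = - ((fun t => ln t) + cst 1) by apply/funext.
  apply: is_derive_eq (is_deriveN (is_deriveD (is_derive1_ln t0) (is_derive_cst _ _ _))) _.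
  by rewrite /= powR_inv1 ?ltW // addr0; field; rewrite gt_eqF.
- apply: is_derive_eq (is_deriveZ _ (is_derive1_powR (- i.+1%:R) t0)) _.
  rewrite /GRing.scale /=.
  have -> : - i.+1%:R - 1 = - i.+2%:R :> R by rewrite -[i.+2%:R]natr1; ring.
  by field; rewrite !lt0r_neq0.
by rewrite /= mulr_ge0 ?powR_ge0 // invr_ge0 mulr_ge0.
Qed.

Lemma xlog_family_at0 : xlog_family 0 c @[c --> 0^'+] --> (0 : R).
Proof.
have pc : (fun c : R => - (2 * c `^ 2^-1)) @ 0^'+ --> (0 : R).
  rewrite -[X in _ --> X]oppr0; apply: cvgN.
  rewrite -[X in _ --> X](mulr0 2); apply: cvgMl_tmp.
  by apply: powR_cvg0; rewrite invr_gt0.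
apply: (squeeze_cvgr _ pc (cvg_cst (0 : R))); near=> c.
have c0 : 0 < c by near: c; exact: nbhs_right_gt.
have c1 : c <= 1 by near: c; exact: nbhs_right_le.
apply/andP; split; last by apply: mulr_ge0_le0; [exact: ltW|exact: ln_le0].
(* ln y < y at y = c^(-1/2) bounds - ln c by 2 c^(-1/2). *)
have := @ln_sublinear R (c `^ (- 2^-1)) (powR_gt0 _ c0).
rewrite ln_powR => h.
have E : c `^ 2^-1 = c * c `^ (- 2^-1).
  rewrite -{2}(powRr1 (ltW c0)) -powRD; last by rewrite (gt_eqF c0) implybT.
  by congr (_ `^ _); lra.
rewrite E /=; have -> : - (2 * (c * c `^ (- 2^-1))) = c * (- 2 * c `^ (- 2^-1)) by ring.
rewrite ler_pM2l //; lra.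
Unshelve. all: by end_near. Qed.

End XLogFamily.

Section TraceSeries.
Local Open Scope classical_set_scope.
Local Open Scope ring_scope.
Context {R : realType}.
Implicit Types (p s t sg : R).

(** The trace of f (t - B), with f = phi 0. *)
Definition trace_series (phi : nat -> R -> R) n (B : 'M[R]_n) t : R :=
  limn (series (fun i => phi i t * \tr (B ^+ i))).

Lemma rho_lt_cvg phi n (B : 'M[R]_n) t i j : pos_taylor_family phi -> lemx 0 B ->
  rho_lt B t -> cvgn (series (fun k => phi k t * (B ^+ k) i j)).
Proof.
move=> pphi B0 rB; have t0 := rho_lt_gt0 rB; case: rB => K [r [K0 r0 rt HK]].
apply: cvg_tail_bounded => [k|].
  by rewrite mulr_ge0 ?(proj2 pphi) //; have := expmx_ge0 k.+2 B0 i j; rewrite mxE.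
exact: (tail_bounded_geometric pphi r0 rt K0).
Qed.

Lemma rho_lt_tail_bounded phi n (B : 'M[R]_n) t : pos_taylor_family phi ->
  rho_lt B t -> tail_bounded (fun i => phi i t * \tr (B ^+ i)).
Proof.
move=> pphi [K [r [K0 r0 rt HK]]].
apply: (tail_bounded_geometric pphi r0 rt _ (trace_exp_le HK)).
by rewrite mulr_ge0.
Qed.

Lemma rho_lt_trace_cvg phi n (B : 'M[R]_n) t : pos_taylor_family phi -> lemx 0 B ->
  rho_lt B t -> cvgn (series (fun i => phi i t * \tr (B ^+ i))).
Proof.
move=> pphi B0 rB; apply: cvg_tail_bounded => [k|]; last exact: rho_lt_tail_bounded.
by rewrite mulr_ge0 ?trace_exp_ge0 ?(proj2 pphi) // (rho_lt_gt0 rB).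
Qed.

Lemma tr_split_pow sg p n (B : 'M[R]_n) t : p <= 2 -> 0 <= sg * (p * (p - 1)) ->
  sg * sg = 1 -> lemx 0 B -> rho_lt B t ->
  \tr (split_pow t B p) = sg * trace_series (pow_family sg p) B t.
Proof.
move=> p2 sp sg1 B0 rB; have t0 := rho_lt_gt0 rB.
have pphi := pow_family_pos p2 sp.
pose M i := (rbinom p i * (- t) ^- i) *: B ^+ i.
have tp0 : t `^ p != 0 by rewrite gt_eqF // powR_gt0.
have ME i : sg * (t `^ p)^-1 * pow_family sg p i t = rbinom p i * (- t) ^- i.
  rewrite pow_familyE //; set x := rbinom p i * _.
  transitivity (sg * sg * (t `^ p / t `^ p) * x); first by ring.
  by rewrite sg1 mulfV // !mul1r.
have cM i j : cvgn (series (fun k => M k i j)).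
  have -> : (fun k => M k i j) =
      (sg * (t `^ p)^-1) *: (fun k => pow_family sg p k t * (B ^+ k) i j).
    by apply/funext => k; rewrite /M mxE -ME -mulrA.
  exact: is_cvg_seriesZ (rho_lt_cvg (i := i) (j := j) pphi B0 rB).
have cT := trace_mul_series_cvg (W := 1%:M) cM.
rewrite /split_pow mxtraceZ -/M -[limn _]mul1mx /trace_series.
have cv := rho_lt_trace_cvg pphi B0 rB; set l := limn (series _) in cv *.
have E : series (fun k => \tr (1%:M *m M k)) =
    (fun N => sg * (t `^ p)^-1 * series (fun k => pow_family sg p k t * \tr (B ^+ k)) N).
  apply/funext => N; rewrite /series /= mulr_sumr; apply: eq_bigr => k _.
  by rewrite mulrA ME mul1mx mxtraceZ.
have cv' := cvgMl_tmp (a := sg * (t `^ p)^-1) cv.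
rewrite E in cT; rewrite (cvg_unique _ cT (cv' _)) //.
by rewrite mulrA mulrCA mulfV // mulr1.
Qed.

(** Summation by parts: multiplying the logarithmic series by t - B telescopes
    its coefficients 1 / k into 1 / (k (k - 1)), up to a remainder that tends to
    0. *)
Lemma tr_mul_split_log n (B : 'M[R]_n) t : lemx 0 B -> rho_lt B t ->
  \tr ((t%:M - B) *m split_log t B) = trace_series xlog_family B t.
Proof.
move=> B0 rB; have t0 := rho_lt_gt0 rB; have [K [r [K0 r0 rt HK]]] := rB.
pose M i := (i.+1%:R * t ^+ i.+1)^-1 *: B ^+ i.+1.
pose q := r / t.
have q0 : 0 <= q by rewrite divr_ge0 // ltW.
have q1 : q < 1 by rewrite ltr_pdivrMr // mul1r.
have Bk0 k i j : 0 <= (B ^+ k) i j by have := expmx_ge0 k B0 i j; rewrite mxE.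
have cM i j : cvgn (series (fun k => M k i j)).
  apply: (@series_le_cvg _ _ (geometric K q)) => [k|k|k|].
  - by rewrite mxE mulr_ge0 // invr_ge0 mulr_ge0 // exprn_ge0 // ltW.
  - by rewrite /geometric /= mulr_ge0 // exprn_ge0.
  - rewrite mxE /geometric /= mulrC ler_pdivrMr ?mulr_gt0 ?exprn_gt0 //.
    apply: le_trans (HK _ _ _) _; rewrite -mulrA ler_wpM2l //.
    rewrite /q expr_div_n exprS [t ^+ k.+1]exprS.
    have -> : r ^+ k / t ^+ k * (k.+1%:R * (t * t ^+ k)) = r ^+ k * (k.+1%:R * t).
      by field; rewrite expf_neq0 ?gt_eqF.
    rewrite mulrC ler_wpM2l ?exprn_ge0 // (le_trans (ltW rt)) // ler_peMl ?ler1n ?ltW //.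
  - by apply: is_cvg_geometric_series; rewrite ger0_norm.
have cT := trace_mul_series_cvg (W := t%:M - B) cM.
rewrite /split_log -/M mulmxBr raddfB /= mul_mx_scalar mxtraceZ.
set W := t%:M - B in cT *.
apply/esym; rewrite /trace_series; apply: cvg_lim => //.
have Wk k : \tr (W *m B ^+ k) = t * \tr (B ^+ k) - \tr (B ^+ k.+1).
  by rewrite mulmxBl mul_scalar_mx raddfB /= mxtraceZ exprS.
pose rem N := \tr (B ^+ N.+2) * (N.+1%:R * t ^+ N.+1)^-1.
have E N : series (fun i => xlog_family i t * \tr (B ^+ i)) (N + 2)%N =
    ln t * \tr W - series (fun k => \tr (W *m M k)) N.+1 - rem N.
  elim: N => [|N IH].
    rewrite /series /= !big_mkord !big_ord_recr !big_ord0 /= /rem /M.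
    rewrite -scalemxAr mxtraceZ Wk; have := Wk 0%N; rewrite expr0 mulmx1 => ->.
    by rewrite expr1 /=; field; rewrite gt_eqF.
  rewrite addSn seriesSr /= IH [series _ N.+2]seriesSr /= addn2 /= /rem /M.
  rewrite -scalemxAr mxtraceZ Wk powRN powR_mulrn ?ltW //=.
  rewrite [t ^+ N.+2]exprS; field.
  by rewrite ?gt_eqF ?exprn_gt0 //= -?natr1 ?addr_gt0.
have remc : rem @ \oo --> (0 : R).
  apply: (@squeeze_cvgr _ _ _ _ (fun=> 0) (fun N => n%:R * K * r * harmonic N)).
  - near=> N; rewrite /rem /harmonic /=; apply/andP; split.
      by rewrite mulr_ge0 ?trace_exp_ge0 // invr_ge0 mulr_ge0 // exprn_ge0 // ltW.
    rewrite invfM mulrCA mulrC; apply: ler_wpM2r; first by rewrite invr_ge0.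
    rewrite ler_pdivrMr ?exprn_gt0 //; apply: le_trans (trace_exp_le HK _) _.
    rewrite exprS mulrA; apply: ler_wpM2l; first by rewrite !mulr_ge0.
    by apply: lerXn2r; rewrite ?nnegrE // ltW.
  - exact: cvg_cst.
  - rewrite -[X in _ --> X](mulr0 (n%:R * K * r)).
    by apply: cvgMl_tmp; exact: cvg_harmonic.
rewrite -(cvg_shiftn 2).
rewrite (_ : [sequence _]_n = (fun N =>
  ln t * \tr W - series (fun k => \tr (W *m M k)) N.+1 - rem N)); last exact/funext.
rewrite -[ln t * \tr W - \tr (W *m limn _)]subr0; apply: cvgB => //.
apply: cvgB; first exact: cvg_cst.
by have := cT; rewrite -(cvg_shiftS).
Unshelve. all: by end_near. Qed.

End TraceSeries.

(** * Traces of powers and complex eigenvalues *)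

Section PowerTraces.

Lemma trig_exp_diag (F : pzRingType) n (T : 'M[F]_n) k : is_trig_mx T ->
  is_trig_mx (T ^+ k) /\ forall j, (T ^+ k) j j = T j j ^+ k.
Proof.
move=> /is_trig_mxP tT; elim: k => [|k [/is_trig_mxP IH1 IH2]].
  split=> [|j]; last by rewrite !expr0 mxE eqxx.
  by apply/is_trig_mxP => i j ij; rewrite expr0 mxE -val_eqE ltn_eqF.
split => [|j].
  apply/is_trig_mxP => i j ij; rewrite exprS -mulmxE mxE big1 // => l _.
  case: (ltnP i l) => [il|li]; first by rewrite tT // mul0r.
  by rewrite IH1 ?mulr0 // (leq_ltn_trans li).
rewrite !exprS -mulmxE mxE (bigD1 j) //= big1 => [|l lj]; first by rewrite addr0 IH2.
case: (ltnP j l) => [jl|]; first by rewrite tT // mul0r.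
by rewrite leq_eqVlt val_eqE (negbTE lj) /= => lj'; rewrite IH1 ?mulr0.
Qed.

Lemma conj_exp (F : fieldType) n (P X : 'M[F]_n) k : P \in unitmx ->
  (P *m X *m invmx P) ^+ k = P *m X ^+ k *m invmx P.
Proof.
move=> uP; elim: k => [|k IH]; first by rewrite !expr0 mulmx1 mulmxV.
by rewrite exprS IH exprS -!mulmxE !mulmxA mulmxKV.
Qed.

Import complex.
Local Open Scope complex_scope.
Context {R : realType}.

Lemma norm_real_complex (x : R) : `|x%:C| = `|x|%:C.
Proof. by rewrite normc_def /= expr0n addr0 sqrtr_sqr. Qed.

Lemma norm_complexE (z : R[i]) : `|z| = (complex.Re `|z|)%:C.
Proof. by rewrite RRe_real ?normr_real. Qed.

(** The trace of X^i is the sum of the i-th powers of the complex eigenvalues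
    of X, which have modulus at most 1. Those equal to 1 contribute their
    number mu, and the powers of any other one have bounded partial sums. *)
Lemma trace_exp_mean n (X : 'M[R]_n) :
  (forall t : R, 1 < t -> exists K : R, forall k i j, `|(X ^+ k) i j| <= K * t ^+ k) ->
  exists mu M : R, forall N, `|\sum_(i < N) (\tr (X ^+ i.+1) - mu)| <= M.
Proof.
move=> hX.
pose XC : 'M[R[i]]_n := map_mx (real_complex R) X.
have XCk k : XC ^+ k = map_mx (real_complex R) (X ^+ k).
  elim: k => [|k IH]; first by rewrite !expr0 map_mx1.
  by rewrite !exprS IH -!mulmxE map_mxM.
have [P Pu /=] : exists2 P : 'M[R[i]]_n, P \in unitmx & is_trig_mx (P *m XC *m invmx P).
  have [|P Pu /=] := @spectral.cotrigonalization _ n [:: XC].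
    by move=> A B; rewrite !inE => /eqP -> /eqP ->.
  rewrite andbT => PT; have uP := spectral.unitarymx_unit Pu; exists P => //.
  by move: PT; rewrite /similar_to conjumx.
set T := P *m XC *m invmx P => tT.
pose lam j := T j j.
have trE k : (\tr (X ^+ k))%:C = \sum_j lam j ^+ k.
  rewrite -trace_map_mx -XCk -[XC ^+ k]mulmx1 -(mulVmx Pu) mulmxA mxtrace_mulC.
  rewrite mulmxA -conj_exp //.
  by apply: eq_bigr => j _; have [_ ->] := trig_exp_diag k tT.
have lam1 j : `|lam j| <= 1.
  rewrite norm_complexE -[1]/(1%:C) lecR; set l := complex.Re _.
  apply/ler_addgt0Pr => e e0.
  have [K HK] := hX (1 + e) (ltr_pwDr e0 (lexx 1)).
  pose kap := \sum_a \sum_b `|P j a| * `|(invmx P) b j|.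
  apply: (@le_of_geometric _ _ _ (K * complex.Re kap)) => [|k].
    by rewrite addr_gt0.
  rewrite -lecR rmorphXn /= -norm_complexE -normrX.
  have [_ <-] := trig_exp_diag k tT.
  have kapE : kap = (complex.Re kap)%:C.
    rewrite RRe_real // ger0_real // sumr_ge0 // => a _.
    by rewrite sumr_ge0 // => b _; rewrite mulr_ge0.
  have -> : (K * complex.Re kap * (1 + e) ^+ k)%:C = kap * (K * (1 + e) ^+ k)%:C.
    by rewrite [in RHS]kapE -rmorphM /=; congr (_%:C); ring.
  rewrite conj_exp // XCk mxE; apply: le_trans (ler_norm_sum _ _ _) _.
  rewrite /kap exchange_big mulr_suml; apply: ler_sum => b _.
  rewrite normrM mxE mulr_suml.
  apply: le_trans (ler_wpM2r (normr_ge0 _) (ler_norm_sum _ _ _)) _.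
  rewrite mulr_suml; apply: ler_sum => a _.
  rewrite normrM mulrAC; apply: ler_wpM2l; first exact: mulr_ge0.
  by rewrite mxE norm_real_complex lecR.
pose mu : nat := #|[pred j | lam j == 1]|.
pose MC := \sum_(j | lam j != 1) 2 / `|1 - lam j|.
have MCE : MC = (complex.Re MC)%:C.
  by rewrite RRe_real // ger0_real // sumr_ge0 // => a _; rewrite divr_ge0.
exists mu%:R, (complex.Re MC) => N.
rewrite -lecR -MCE -norm_real_complex.
have -> : (\sum_(i < N) (\tr (X ^+ i.+1) - mu%:R))%:C =
    \sum_(j | lam j != 1) \sum_(i < N) lam j ^+ i.+1.
  rewrite rmorph_sum exchange_big /=; apply: eq_bigr => i _.
  rewrite rmorphB /= trE rmorph_nat (bigID (fun j => lam j == 1)) /=.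
  have -> : \sum_(j | lam j == 1) lam j ^+ i.+1 = mu%:R.
    rewrite (eq_bigr (fun=> 1)) => [|j /eqP ->]; last by rewrite expr1n.
    by rewrite sumr_const.
  by rewrite addrAC subrr add0r.
apply: le_trans (ler_norm_sum _ _ _) _; apply: ler_sum => j lj.
have l0 : 0 < `|1 - lam j| by rewrite normr_gt0 subr_eq0 eq_sym.
rewrite ler_pdivlMr // -normrM.
have -> : (\sum_(i < N) lam j ^+ i.+1) * (1 - lam j) = lam j - lam j ^+ N.+1.
  elim: N => [|N IH]; first by rewrite big_ord0 mul0r expr1 subrr.
  by rewrite big_ord_recr /= mulrDl IH mulrBr mulr1 [lam j ^+ N.+2]exprSr; ring.
apply: le_trans (ler_normB _ _) _; rewrite -[2]/(1 + 1); apply: lerD => //.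
by rewrite normrX exprn_ile1.
Qed.

End PowerTraces.

(** * The traces of f (A) and the limit of exponent 0 *)

Section ZeroPower.
Local Open Scope classical_set_scope.
Local Open Scope ring_scope.
Context {R : realType}.
Implicit Types (p q : R).

Lemma abel_sum_le (c g : nat -> R) (M : R) N :
  (forall i, 0 <= c i) -> (forall i, c i.+1 <= c i) ->
  (forall k, `|\sum_(i < k) g i| <= M) ->
  `|\sum_(i < N) c i * g i| <= M * c 0%N.
Proof.
move=> c0 cS gM; have M0 : 0 <= M by apply: le_trans (gM 0%N).
case: N => [|N]; first by rewrite big_ord0 normr0 mulr_ge0.
have -> : \sum_(i < N.+1) c i * g i = c N * (\sum_(i < N.+1) g i)
    + \sum_(i < N) (c i - c i.+1) * \sum_(j < i.+1) g j.
  elim: N => [|N IH]; first by rewrite big_ord0 !big_ord1 addr0.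
  by rewrite big_ord_recr /= IH [in RHS]big_ord_recr /= [X in _ = _ + X]big_ord_recr /=; ring.
apply: le_trans (_ : c N * M + \sum_(i < N) (c i - c i.+1) * M <= _).
  apply: le_trans (ler_normD _ _) _; apply: lerD.
    by rewrite normrM ger0_norm // ler_wpM2l.
  apply: le_trans (ler_norm_sum _ _ _) _; apply: ler_sum => i _.
  by rewrite normrM ger0_norm ?subr_ge0 // ler_wpM2l ?subr_ge0.
rewrite -mulr_suml -mulrDl mulrC; apply: ler_wpM2l => //.
elim: N => [|N IH]; first by rewrite big_ord0 addr0.
by rewrite big_ord_recr /=; lra.
Qed.

Definition binom_sum q N : R := \sum_(i < N.+1) signed_binom q i.

Lemma signed_binomS_sum q N : signed_binom q N.+1 = - (q * binom_sum q N * harmonic N).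
Proof.
suff H : signed_binom q N.+1 * N.+1%:R = - (q * binom_sum q N).
  by rewrite /harmonic /= -mulNr -H mulfK // pnatr_eq0.
elim: N => [|N IH].
  by rewrite signed_binomS /binom_sum big_ord1 signed_binom0; ring.
rewrite signed_binomS /binom_sum big_ord_recr /= -/(binom_sum q N).
by rewrite mulrBr IH; ring.
Qed.

Lemma binom_sumS q N : binom_sum q N.+1 = binom_sum q N * (1 - q * harmonic N).
Proof.
rewrite {1}/binom_sum big_ord_recr /= -/(binom_sum q N) signed_binomS_sum.
by rewrite /harmonic /=; ring.
Qed.

Section UnitInterval.
Variable q : R.
Hypothesis q01 : 0 < q <= 1.

Let q_harm N : 0 <= 1 - q * harmonic N.
Proof.
have /andP[q0 q1] := q01.
by rewrite subr_ge0 /harmonic /= ler_pdivrMr // mul1r (le_trans q1) // ler1n.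
Qed.

Lemma binom_sum_ge0 N : 0 <= binom_sum q N.
Proof.
elim: N => [|N IH]; last by rewrite binom_sumS mulr_ge0.
by rewrite /binom_sum big_ord1 signed_binom0.
Qed.

Lemma binom_sum_noninc N : binom_sum q N.+1 <= binom_sum q N.
Proof.
have /andP[q0 q1] := q01.
rewrite binom_sumS ler_piMr ?binom_sum_ge0 // lerBlDr lerDl mulr_ge0 ?ltW //.
by rewrite /harmonic /= invr_gt0.
Qed.

Lemma abs_binom_ge0 N : 0 <= - signed_binom q N.+1.
Proof.
have /andP[q0 q1] := q01.
by rewrite signed_binomS_sum opprK !mulr_ge0 ?binom_sum_ge0 ?ltW // /harmonic /= invr_gt0.
Qed.

Lemma abs_binom_noninc N : - signed_binom q N.+2 <= - signed_binom q N.+1.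
Proof.
have /andP[q0 q1] := q01.
rewrite !signed_binomS_sum !opprK; apply: ler_pM.
- by rewrite mulr_ge0 ?binom_sum_ge0 ?ltW.
- by rewrite /harmonic /= invr_ge0.
- by rewrite ler_pM2l // binom_sum_noninc.
- by rewrite /harmonic /= lef_pV2 ?posrE // ler_nat.
Qed.

Lemma sum_abs_binom N : \sum_(i < N) - signed_binom q i.+1 = 1 - binom_sum q N.
Proof.
rewrite /binom_sum big_ord_recl signed_binom0 sumrN.
by under [in RHS]eq_bigr do rewrite lift0; ring.
Qed.

(** If the partial sums of the signed binomial coefficients did not tend to 0,
    the coefficients would be at least a multiple of the harmonic sequence. *)
Lemma binom_sum_cvg0 : binom_sum q @ \oo --> (0 : R).
Proof.
have /andP[q0 q1] := q01.
have noninc : nonincreasing_seq (binom_sum q).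
  by apply/nonincreasing_seqP => N; exact: binom_sum_noninc.
have lb : has_lbound (range (binom_sum q)).
  by exists 0 => _ [N _ <-]; exact: binom_sum_ge0.
have cv := nonincreasing_is_cvgn noninc lb.
suff l0 : limn (binom_sum q) = 0 by rewrite -l0.
have lge : 0 <= limn (binom_sum q).
  by apply: limr_ge => //; near=> N; exact: binom_sum_ge0.
apply/eqP; rewrite eq_le lge andbT leNgt; apply/negP => lgt.
set l := limn _ in lgt.
have lN N : l <= binom_sum q N by exact: nonincreasing_cvgn_ge.
apply: (@dvg_harmonic R); apply: nondecreasing_is_cvgn.
  apply/nondecreasing_seqP => N; rewrite seriesSr lerDl /harmonic /= invr_ge0 //.
exists ((q * l)^-1) => _ [N _ <-].
rewrite -[X in _ <= X]mul1r ler_pdivlMr ?mulr_gt0 //.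
apply: le_trans (_ : 1 - binom_sum q N <= 1); last by rewrite gerBl binom_sum_ge0.
rewrite -sum_abs_binom /series /= big_mkord mulr_suml; apply: ler_sum => i _.
rewrite signed_binomS_sum opprK mulrC; apply: ler_wpM2r.
  by rewrite invr_ge0.
by rewrite ler_pM2l.
Unshelve. all: by end_near. Qed.

(** The coefficients - signed_binom q i.+1 are nonnegative, decreasing and of
    sum 1, and the first of them is q. Abel summation therefore bounds by M q
    the contribution of a sequence whose partial sums are bounded by M. *)
Lemma binom_series_near (x : nat -> R) (mu M : R) :
  (forall N, `|\sum_(i < N) (x i.+1 - mu)| <= M) ->
  cvgn (series (fun i => signed_binom q i * x i)) ->
  `|limn (series (fun i => signed_binom q i * x i)) - (x 0%N - mu)| <= M * q.
Proof.
have /andP[q0 q1] := q01.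
move=> xM cx; set u := series _ in cx *.
have uE N : u N.+1 - (x 0%N - mu) =
    mu * binom_sum q N - \sum_(i < N) - signed_binom q i.+1 * (x i.+1 - mu).
  rewrite /u /series /= big_mkord big_ord_recl signed_binom0.
  have -> : \sum_(i < N) - signed_binom q i.+1 * (x i.+1 - mu) =
      - (\sum_(i < N) signed_binom q (lift ord0 i) * x (lift ord0 i))
      - (1 - binom_sum q N) * mu.
    rewrite -sum_abs_binom mulr_suml -sumrN -sumrB; apply: eq_bigr => i _.
    by rewrite lift0; ring.
  by ring.
have cl : `|u N.+1 - (x 0%N - mu)| @[N --> \oo] --> `|limn u - (x 0%N - mu)|.
  apply: cvg_norm; apply: cvgB; last exact: cvg_cst.
  by rewrite (cvg_shiftS u).
have cr : `|mu| * binom_sum q N + M * q @[N --> \oo] --> M * q.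
  rewrite -[X in _ --> X]add0r -[X in _ --> X + _](mulr0 `|mu|).
  by apply: cvgD; [apply: cvgMl_tmp; exact: binom_sum_cvg0|exact: cvg_cst].
apply: (ler_cvg_to cl cr); near=> N.
rewrite uE; apply: le_trans (ler_normB _ _) _; apply: lerD.
  by rewrite normrM [X in _ * X]ger0_norm // binom_sum_ge0.
have := @abel_sum_le (fun i => - signed_binom q i.+1) (fun i => x i.+1 - mu) M N.
rewrite (_ : - signed_binom q 1 = q); last first.
  by rewrite signed_binomS_sum /binom_sum big_ord1 signed_binom0 /harmonic /= invr1; ring.
by apply => //; [exact: abs_binom_ge0|exact: abs_binom_noninc].
Unshelve. all: by end_near. Qed.

End UnitInterval.
End ZeroPower.

Section Values.
Local Open Scope classical_set_scope.
Local Open Scope ring_scope.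
Context {R : realType}.
Implicit Types (p q s t sg : R) (phi : nat -> R -> R).

Lemma trace_mx0 (M : 'M[R]_0) : \tr M = 0.
Proof. by rewrite /mxtrace big_ord0. Qed.

Lemma trace_series_mx0 phi (B : 'M[R]_0) t : trace_series phi B t = 0.
Proof.
rewrite /trace_series (_ : series _ = fun=> 0) ?lim_cst //.
by apply/funext => N; rewrite /series /= big1 // => i _; rewrite trace_mx0 mulr0.
Qed.

(** The constants in the bounds on the entries of B^k may blow up as t decreases
    to s. The bound t^k on the diagonal entries involves no such constant and
    passes to the limit. *)
Lemma M_matrix_trace_exp_le n (C : 'M[R]_n) k : M_matrix C ->
  \tr (split_rest C ^+ k) <= n%:R * split_scalar C ^+ k.
Proof.
move=> hC.
have cl : n%:R * t ^+ k @[t --> (split_scalar C)^'+] --> n%:R * split_scalar C ^+ k.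
  by apply: cvgMl_tmp; apply: cvg_at_right_filter; exact: exprn_continuous.
apply: (ler_cvg_to (cvg_cst _) cl); near=> t.
have st : split_scalar C < t by near: t; exact: nbhs_right_gt.
apply: le_trans (_ : \sum_(i < n) t ^+ k <= _); last by rewrite sumr_const card_ord mulr_natl.
apply: ler_sum => i _; apply: diag_exp_le; first exact: split_rest_lemx.
exact: M_matrix_rho_lt.
Unshelve. all: by end_near. Qed.

(** The trace of f (C) for an M-matrix C and a function f with f (0+) = 0. *)
Definition trace_value phi n (C : 'M[R]_n) : R :=
  if split_scalar C == 0 then 0 else trace_series phi (split_rest C) (split_scalar C).

(** If s = split_scalar C is 0, then all traces of positive powers of
    split_rest C vanish and the series is reduced to n phi 0 t. Otherwise the
    series still converges at s, even for a singular C, because f (0+) is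
    finite. *)
Lemma trace_value_cvg phi n (C : 'M[R]_n) : pos_taylor_family phi ->
  phi 0%N c @[c --> 0^'+] --> (0 : R) -> M_matrix C ->
  trace_series phi (split_rest C) t @[t --> (split_scalar C)^'+] --> trace_value phi C.
Proof.
move=> pphi phi0 hC; have B0 := split_rest_lemx hC.
rewrite /trace_value; have [s0|s0] := eqVneq (split_scalar C) 0; last first.
  have sgt0 : 0 < split_scalar C by rewrite lt_def s0 split_scalar_ge0.
  apply: (taylor_series_right_cvg pphi sgt0 (fun i => trace_exp_ge0 i B0)).
  apply: (tail_bounded_at0 pphi phi0 sgt0 (K := n%:R)) => // i.
  exact: M_matrix_trace_exp_le.
have b0 k : \tr (split_rest C ^+ k.+1) = 0.
  apply/eqP; rewrite eq_le trace_exp_ge0 // andbT.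
  by have := M_matrix_trace_exp_le k.+1 hC; rewrite s0 expr0n mulr0.
rewrite s0 -[X in _ --> X](mul0r (n%:R : R)).
have -> : trace_series phi (split_rest C) = (fun t => phi 0%N t * n%:R).
  apply/funext => t; apply: cvg_lim => //; rewrite -(cvg_shiftS _).
  rewrite (_ : [sequence _]_n = fun=> phi 0%N t * n%:R); first exact: cvg_cst.
  apply/funext => N; rewrite /series /= big_mkord big_ord_recl big1 => [|i _].
    by rewrite expr0 mxtrace1 addr0.
  by rewrite lift0 b0 mulr0.
by apply: cvgMr_tmp; exact: phi0.
Qed.

Lemma M_matrix_unit_cvg phi n (C : 'M[R]_n) : pos_taylor_family phi -> M_matrix C ->
  C \in unitmx ->
  trace_series phi (split_rest C) t @[t --> (split_scalar C)^'+] -->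
    trace_series phi (split_rest C) (split_scalar C).
Proof.
case: n C => [|n] C pphi hC uC.
  rewrite trace_series_mx0 (_ : trace_series phi _ = fun=> 0); first exact: cvg_cst.
  by apply/funext => t; rewrite trace_series_mx0.
have rB := M_matrix_unit_rho_lt hC uC (ltn0Sn n).
apply: (taylor_series_right_cvg pphi (rho_lt_gt0 rB)) => [i|].
  exact: trace_exp_ge0 (split_rest_lemx hC).
exact: rho_lt_tail_bounded.
Qed.

Lemma unit_trace_value phi n (C : 'M[R]_n) : M_matrix C -> C \in unitmx ->
  trace_value phi C = trace_series phi (split_rest C) (split_scalar C).
Proof.
case: n C => [|n] C hC uC; first by rewrite /trace_value trace_series_mx0; case: ifP.
by rewrite /trace_value gt_eqF // (rho_lt_gt0 (M_matrix_unit_rho_lt hC uC (ltn0Sn n))).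
Qed.

Lemma tr_mx_pow sg p n (C : 'M[R]_n) : p <= 2 -> 0 <= sg * (p * (p - 1)) ->
  sg * sg = 1 -> M_matrix C -> C \in unitmx ->
  \tr (mx_pow C p) = sg * trace_series (pow_family sg p) (split_rest C) (split_scalar C).
Proof.
case: n C => [|n] C p2 sp sg1 hC uC; first by rewrite trace_mx0 trace_series_mx0 mulr0.
rewrite /mx_pow (tr_split_pow p2 sp sg1) //; first exact: split_rest_lemx.
exact: M_matrix_unit_rho_lt.
Qed.

Lemma sing_tr_powE sg p n (C : 'M[R]_n) : 0 < p -> p <= 2 ->
  0 <= sg * (p * (p - 1)) -> sg * sg = 1 -> M_matrix C ->
  sing_tr_pow C p = sg * trace_value (pow_family sg p) C.
Proof.
move=> p0 p2 sp sg1 hC; apply: cvg_lim => //.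
have pphi := pow_family_pos p2 sp.
have cv := cvgMl_tmp (a := sg) (trace_value_cvg pphi (pow_family_at0 _ p0) hC).
apply: cvg_trans (cv _); apply: near_eq_cvg; near=> t.
have st : split_scalar C < t by near: t; exact: nbhs_right_gt.
rewrite (tr_split_pow p2 sp sg1) //; first exact: split_rest_lemx.
exact: M_matrix_rho_lt.
Unshelve. all: by end_near. Qed.

Lemma tr_pow_gt0 sg p n (C : 'M[R]_n) : 0 < p -> p <= 2 ->
  0 <= sg * (p * (p - 1)) -> sg * sg = 1 -> M_matrix C ->
  tr_pow C p = (sg * trace_value (pow_family sg p) C)%:E.
Proof.
move=> p0 p2 sp sg1 hC; rewrite /tr_pow; case: ifPn => uC.
  by rewrite (tr_mx_pow p2 sp sg1) // unit_trace_value.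
by rewrite ltNge (ltW p0) gt_eqF //= (sing_tr_powE p0 p2 sp sg1).
Qed.

Lemma tr_mul_logE n (C : 'M[R]_n) : M_matrix C ->
  tr_mul_log C = trace_value xlog_family C.
Proof.
move=> hC; have B0 := split_rest_lemx hC; rewrite /tr_mul_log; case: ifPn => uC.
  rewrite unit_trace_value // {1}(split_scalarK C).
  case: n C hC B0 uC => [|n] C hC B0 uC; first by rewrite trace_mx0 trace_series_mx0.
  by rewrite tr_mul_split_log //; exact: M_matrix_unit_rho_lt.
apply: cvg_lim => //.
apply: cvg_trans (trace_value_cvg xlog_family_pos xlog_family_at0 hC).
apply: near_eq_cvg; near=> t.
have st : split_scalar C < t by near: t; exact: nbhs_right_gt.
by rewrite tr_mul_split_log //; exact: M_matrix_rho_lt.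
Unshelve. all: by end_near. Qed.

Lemma scalemx_exp n (a : R) (B : 'M[R]_n) k : (a *: B) ^+ k = a ^+ k *: B ^+ k.
Proof.
elim: k => [|k IH]; first by rewrite !expr0 scale1r.
by rewrite !exprS IH -!mulmxE -scalemxAl -scalemxAr scalerA.
Qed.

(** For an invertible C the normalized traces are summable, and mu = 0. *)
Lemma normalized_trace_mean n (C : 'M[R]_n) : M_matrix C -> 0 < split_scalar C ->
  exists mu M : R, (C \in unitmx -> mu = 0) /\
   forall N, `|\sum_(i < N) (\tr (split_rest C ^+ i.+1) / split_scalar C ^+ i.+1 - mu)| <= M.
Proof.
move=> hC s0; have B0 := split_rest_lemx hC.
set s := split_scalar C in s0 *; set B := split_rest C in B0 *.
have [uC|nuC] := boolP (C \in unitmx).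
  case: n C hC @s s0 @B B0 uC => [|n] C hC s s0 B B0 uC.
    exists 0, 0; split => // N; rewrite big1 ?normr0 // => i _.
    by rewrite trace_mx0 mul0r subr0.
  have [K [r [K0 r0 rs HK]]] := M_matrix_unit_rho_lt hC uC (ltn0Sn n).
  pose q := r / s.
  have q0 : 0 <= q by rewrite divr_ge0 // ltW.
  have q1 : q < 1 by rewrite ltr_pdivrMr // mul1r.
  exists 0, (n.+1%:R * K / (1 - q)); split => // N.
  rewrite ger0_norm; last first.
    apply: sumr_ge0 => i _; rewrite subr0; apply: divr_ge0; first exact: trace_exp_ge0.
    by rewrite exprn_ge0 // ltW.
  rewrite ler_pdivlMr ?subr_gt0 //.
  apply: le_trans (_ : (\sum_(i < N) n.+1%:R * K * q ^+ i.+1) * (1 - q) <= _).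
    apply: ler_wpM2r; first by rewrite subr_ge0 ltW.
    apply: ler_sum => i _; rewrite subr0 /q expr_div_n mulrA; apply: ler_wpM2r.
      by rewrite invr_ge0 exprn_ge0 // ltW.
    exact: (trace_exp_le HK).
  rewrite -mulr_sumr -mulrA -[X in _ <= X]mulr1; apply: ler_wpM2l; first by rewrite mulr_ge0.
  have -> : (\sum_(i < N) q ^+ i.+1) * (1 - q) = q - q ^+ N.+1.
    elim: N => [|N IH]; first by rewrite big_ord0 mul0r expr1 subrr.
    by rewrite big_ord_recr /= mulrDl IH mulrBr mulr1 [q ^+ N.+2]exprSr; ring.
  by rewrite (le_trans _ (ltW q1)) // gerBl exprn_ge0.
have [t t1|mu [M HM]] := @trace_exp_mean R n (s^-1 *: B).
  have sts : s < t * s by rewrite ltr_pMl.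
  have [K [r [K0 r0 rs HK]]] := M_matrix_rho_lt hC sts.
  exists K => k i j; rewrite scalemx_exp mxE ger0_norm; last first.
    apply: mulr_ge0; first by rewrite exprn_ge0 // invr_ge0 ltW.
    by have := expmx_ge0 k B0 i j; rewrite mxE.
  rewrite exprVn mulrC ler_pdivrMr ?exprn_gt0 // -mulrA -exprMn.
  apply: le_trans (HK k i j) _; apply: ler_wpM2l => //.
  by apply: lerXn2r; rewrite ?nnegrE ?(le_trans r0) // ltW.
exists mu, M; split => // N.
apply: le_trans (HM N); rewrite le_eqVlt; apply/orP; left; apply/eqP; congr `|_|.
by apply: eq_bigr => i _; rewrite scalemx_exp mxtraceZ exprVn mulrC.
Qed.

(** The number mu is the algebraic multiplicity of the eigenvalue 0 of C: with
    x i the normalized trace, tr C^q is s^q times the binomial series of x, which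
    picks the mean mu of x as q tends to 0. *)
Lemma trace_value_pow_cvg0 n (C : 'M[R]_n) : M_matrix C -> 0 < split_scalar C ->
  exists mu : R, (C \in unitmx -> mu = 0) /\
   - trace_value (pow_family (-1) q) C @[q --> 0^'+] --> n%:R - mu.
Proof.
move=> hC s0; have [mu [M [umu HM]]] := normalized_trace_mean hC s0.
have B0 := split_rest_lemx hC.
exists mu; split => //; set s := split_scalar C in s0 HM *; set B := split_rest C in HM B0 *.
pose x i := \tr (B ^+ i) / s ^+ i.
have x0 : x 0%N = n%:R by rewrite /x !expr0 mxtrace1 divr1.
pose L q := limn (series (fun i => signed_binom q i * x i)).
have main q : 0 < q <= 1 -> - trace_value (pow_family (-1) q) C = s `^ q * L q /\
    `|L q - (n%:R - mu)| <= M * q.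
  move=> q01; have /andP[q0 q1] := q01.
  have pphi : pos_taylor_family (pow_family (-1) q) by apply: pow_family_pos; nra.
  have cT : cvgn (series (fun i => pow_family (-1) q i s * \tr (B ^+ i))).
    apply: cvg_tail_bounded => [i|].
      by rewrite mulr_ge0 ?trace_exp_ge0 // (proj2 pphi).
    apply: (tail_bounded_at0 pphi (pow_family_at0 _ q0) s0 (K := n%:R)) => // i.
    exact: M_matrix_trace_exp_le.
  have sq0 : s `^ q != 0 by rewrite gt_eqF // powR_gt0.
  have E : series (fun i => signed_binom q i * x i) = (fun N => - (s `^ q)^-1 *
      series (fun i => pow_family (-1) q i s * \tr (B ^+ i)) N).
    apply/funext => N; rewrite /series /= mulr_sumr; apply: eq_bigr => i _.
    rewrite /x /pow_family powRB; last by rewrite (gt_eqF s0) implybT.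
    rewrite powR_mulrn ?ltW //; field.
    by rewrite sq0 gt_eqF // exprn_gt0.
  have cv := cvgMl_tmp (a := - (s `^ q)^-1) cT.
  rewrite -E in cv; split.
    rewrite /trace_value gt_eqF // /L (cvg_lim _ (cv _)) // /trace_series -/s -/B.
    by rewrite mulNr mulrN mulrA mulfV // mul1r.
  rewrite -x0; apply: binom_series_near => //.
  exact: (cvgP _ (cv _)).
have Lc : L q @[q --> 0^'+] --> n%:R - mu.
  have z : M * q @[q --> 0^'+] --> (0 : R).
    rewrite -[X in _ --> X](mulr0 M); apply: cvgMl_tmp.
    by apply: cvg_at_right_filter; exact: cvg_id.
  rewrite -[X in _ --> X]add0r.
  rewrite -[X in X @ _](_ : (fun q => (L q - (n%:R - mu)) + (n%:R - mu)) = L); last first.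
    by apply/funext => q; rewrite subrK.
  apply: cvgD; last exact: cvg_cst.
  apply: norm_cvg0; apply: (squeeze_cvgr _ (cvg_cst (0 : R)) z); near=> q.
  rewrite normr_ge0 /=; apply: (proj2 (main q _)); apply/andP; split.
    by near: q; exact: nbhs_right_gt.
  by near: q; exact: nbhs_right_le.
have sc : s `^ q @[q --> 0^'+] --> (1 : R).
  rewrite -(powRr0 s); apply: cvg_at_right_filter.
  rewrite /powR gt_eqF //; apply: continuous_comp; last exact: continuous_expR.
  by apply: cvgMr_tmp; exact: cvg_id.
rewrite -[X in _ --> X]mul1r; apply: cvg_trans (cvgM sc Lc).
apply: near_eq_cvg; near=> q; rewrite (proj1 (main q _)) //; apply/andP; split.
  by near: q; exact: nbhs_right_gt.
by near: q; exact: nbhs_right_le.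
Unshelve. all: by end_near. Qed.

(** At exponent 0 the trace is a limit of traces of small positive powers, also
    when C is invertible. An inequality valid for all small q > 0 therefore passes
    to exponent 0. *)
Lemma tr_pow0 n (C : 'M[R]_n) : M_matrix C -> exists L : R,
  tr_pow C 0 = L%:E /\ - trace_value (pow_family (-1) q) C @[q --> 0^'+] --> L.
Proof.
move=> hC.
have cvgL (L : R) : (- trace_value (pow_family (-1) q) C) @[q --> 0^'+] --> L ->
    C \notin unitmx -> tr_pow C 0 = L%:E.
  move=> cL nuC; rewrite /tr_pow (negbTE nuC) ltxx eqxx; congr (_%:E).
  apply: cvg_lim => //; apply: cvg_trans cL; apply: near_eq_cvg; near=> q.
  have q0 : 0 < q by near: q; exact: nbhs_right_gt.
  have q1 : q <= 1 by near: q; exact: nbhs_right_le.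
  rewrite (@sing_tr_powE (-1) q) ?mulN1r //; nra.
have [s0|s0] := eqVneq (split_scalar C) 0.
  have c0 : - trace_value (pow_family (-1) q) C @[q --> 0^'+] --> (0 : R).
    rewrite /trace_value s0 eqxx oppr0; exact: cvg_cst.
  exists 0; split => //; have [uC|nuC] := boolP (C \in unitmx); last exact: cvgL.
  case: n C hC s0 uC {c0 cvgL} => [|n] C hC s0 uC.
    by rewrite /tr_pow uC trace_mx0.
  by have := rho_lt_gt0 (M_matrix_unit_rho_lt hC uC (ltn0Sn n)); rewrite s0 ltxx.
have sgt0 : 0 < split_scalar C by rewrite lt_def s0 split_scalar_ge0.
have [mu [umu cmu]] := trace_value_pow_cvg0 hC sgt0.
exists (n%:R - mu); split => //; have [uC|nuC] := boolP (C \in unitmx); last exact: cvgL.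
rewrite /tr_pow uC umu // subr0 (@tr_mx_pow 1 0) ?mul1r ?mul0r //.
congr (_%:E); apply: cvg_lim => //; rewrite -(cvg_shiftS _).
rewrite (_ : [sequence _]_n = fun=> n%:R); first exact: cvg_cst.
apply/funext => N; rewrite /series /= big_mkord big_ord_recl big1 => [|i _].
  by rewrite /pow_family signed_binom0 subr0 powRr0 expr0 mxtrace1 !mul1r addr0.
rewrite lift0 /pow_family mul1r signed_binomS_sum.
by rewrite mul0r mul0r oppr0 !mul0r.
Unshelve. all: by end_near. Qed.

End Values.

(** * Supermodularity *)

Section Supermodularity.
Local Open Scope classical_set_scope.
Local Open Scope ring_scope.
Context {R : realType}.
Variables (phi : nat -> R -> R) (pphi : pos_taylor_family phi).

(** Splittings of one matrix C at s and at t differ by the shift t - s of the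
    nonnegative part. *)
Lemma trace_splitting_indep n (C : 'M[R]_n) s t : lemx 0 (s%:M - C) ->
  rho_lt (s%:M - C) s -> s <= t ->
  trace_series phi (s%:M - C) s = trace_series phi (t%:M - C) t.
Proof.
move=> B0 rB st; have [K [r [K0 r0 rs HK]]] := rB.
have d0 : 0 < s - r by rewrite subr_gt0.
have ds : s - r <= s by rewrite gerBl.
apply: (taylor_series_indep pphi (appell_trace C) d0 ds st (K := n%:R * K)) => [|k y sy].
  by rewrite mulr_ge0.
have ys0 : 0 <= y - s by rewrite subr_ge0.
have E : y%:M - C = (y - s)%:M + (s%:M - C) by rewrite raddfB /= addrA subrK.
have -> : y - (s - r) = (y - s) + r by ring.
rewrite E trace_exp_ge0 /=; last first.
  move=> i j; have := B0 i j; rewrite !mxE => h.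
  by apply: addr_ge0 => //; exact: mulrn_wge0.
exact: (trace_exp_le (exp_addscalar_le ys0 HK)).
Qed.

(** The terms of index 0 and 1 are modular in the index set, and the other
    ones have nonnegative coefficients, so that the supermodularity of the
    traces of powers can be used term by term. *)
Lemma trace_series_supermodular n (D : 'M[R]_n) t (I J : {set 'I_n}) :
  lemx 0 D -> rho_lt D t ->
  trace_series phi (principal_submx D I) t + trace_series phi (principal_submx D J) t <=
  trace_series phi (principal_submx D (I :|: J)) t +
  trace_series phi (principal_submx D (I :&: J)) t.
Proof.
move=> D0 rD; have t0 := rho_lt_gt0 rD.
have cX (X : {set 'I_n}) : cvgn (series (fun i => phi i t * \tr (principal_submx D X ^+ i))).
  apply: rho_lt_trace_cvg => //.
    by move=> i j; have := D0 (enum_val i) (enum_val j); rewrite !mxE.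
  by apply: rho_lt_mxsub => //; exact: enum_val_inj.
rewrite /trace_series -!limD //; apply: ler_lim.
- by apply: is_cvgD; exact: cX.
- by apply: is_cvgD; exact: cX.
near=> N; rewrite !fctE /series /= -!big_split /=; apply: ler_sum => -[|k] _.
  rewrite -!mulrDr !expr0 !mxtrace1 -!natrD.
  by rewrite cardsUI.
rewrite -!mulrDr !tr_exp_principal; case: k => [|k].
  by rewrite !expr1 tr_colmask_modular.
by apply: ler_wpM2l; [exact: (proj2 pphi)|exact: tr_exp_supermodular].
Unshelve. all: by end_near. Qed.

(** The value attached to A[X] is a limit, for e tending to 0, of the value of
    the series of A[X] + e in its own splitting. By independence of the
    splitting, all of these can be evaluated at the common scalar S + e, where
    S = split_scalar A, at which the matrix of the splitting of A[X] + e is the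
    principal submatrix of split_rest A. *)
Lemma limit_supermodular m (A : 'M[R]_m) (I J : {set 'I_m}) (V : {set 'I_m} -> R) :
  M_matrix A ->
  (forall X, X \in [:: I; J; I :|: J; I :&: J] ->
    trace_series phi (split_rest (principal_submx A X)) t
      @[t --> (split_scalar (principal_submx A X))^'+] --> V X) ->
  V I + V J <= V (I :|: J) + V (I :&: J).
Proof.
move=> hA hV.
pose s X := split_scalar (principal_submx A X).
pose f X N := trace_series phi (split_rest (principal_submx A X)) (s X + harmonic N).
have h0 N : 0 < harmonic N :> R by rewrite /harmonic /= invr_gt0.
have cf X : X \in [:: I; J; I :|: J; I :&: J] -> f X @ \oo --> V X.
  move=> hX; have /cvg_at_rightP := hV X hX; apply; split => [N|].
    by rewrite ltrDl.
  rewrite -[X in _ --> X]addr0; apply: cvgD; first exact: cvg_cst.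
  exact: cvg_harmonic.
have fE X N : f X N =
    trace_series phi (principal_submx (split_rest A) X) (split_scalar A + harmonic N).
  have hX := M_matrix_principal X hA.
  have E t : t%:M - (principal_submx A X + (harmonic N)%:M) =
      (t - harmonic N)%:M - principal_submx A X.
    by rewrite [in RHS]raddfB /= opprD addrA addrAC.
  have E1 : (s X + harmonic N)%:M - (principal_submx A X + (harmonic N)%:M) =
      split_rest (principal_submx A X) by rewrite E addrK.
  have E2 : (split_scalar A + harmonic N)%:M - (principal_submx A X + (harmonic N)%:M) =
      principal_submx (split_rest A) X.
    by rewrite E addrK; apply/matrixP => i j; rewrite !mxE (inj_eq enum_val_inj).
  rewrite /f -E1 -E2; apply: trace_splitting_indep.
  - by rewrite E1; exact: split_rest_lemx.
  - by rewrite E1; apply: M_matrix_rho_lt => //; rewrite ltrDl.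
  - by rewrite lerD2r split_scalar_principal.
have cI := cf I; have cJ := cf J; have cU := cf (I :|: J); have cN := cf (I :&: J).
rewrite !inE !eqxx ?orbT in cI cJ cU cN.
apply: (ler_cvg_to (cvgD (cI isT) (cJ isT)) (cvgD (cU isT) (cN isT))).
near=> N; rewrite !fctE !fE; apply: trace_series_supermodular.
  exact: split_rest_lemx.
by apply: M_matrix_rho_lt => //; rewrite ltrDl.
Unshelve. all: by end_near. Qed.

Lemma trace_value_supermodular m (A : 'M[R]_m) (I J : {set 'I_m}) :
  M_matrix A -> phi 0%N c @[c --> 0^'+] --> (0 : R) ->
  trace_value phi (principal_submx A I) + trace_value phi (principal_submx A J) <=
  trace_value phi (principal_submx A (I :|: J)) +
  trace_value phi (principal_submx A (I :&: J)).
Proof.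
move=> hA phi0.
apply: (limit_supermodular (V := fun X => trace_value phi (principal_submx A X)) hA).
move=> X _.
by apply: trace_value_cvg => //; exact: M_matrix_principal.
Qed.

End Supermodularity.

Section InvertibleSubmatrices.
Context {R : realType}.

(** For exponents below 0, one singular A[X] would make the left-hand side
    infinite. The bound on the powers of the nonnegative part of A[U], in the
    splitting of A[U], passes to its submatrix on X and makes A[X] invertible. *)
Lemma M_matrix_unit_sub m (A : 'M[R]_m) (X U : {set 'I_m}) : M_matrix A ->
  X \subset U -> principal_submx A U \in unitmx -> principal_submx A X \in unitmx.
Proof.
move=> hA XU uU.
have [X0|/card_gt0P[x xX]] := posnP #|X|.
  by move: (principal_submx A X); rewrite X0 => M; rewrite unitmxE det_mx00 unitr1.
have U0 : (0 < #|U|)%N by apply/card_gt0P; exists x; exact: (fintype.subsetP XU).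
have hU := M_matrix_principal U hA.
have rB := M_matrix_unit_rho_lt hU uU U0.
have xU (i : 'I_#|X|) : enum_val i \in U by apply: (fintype.subsetP XU); exact: enum_valP.
pose f (i : 'I_#|X|) : 'I_#|U| := enum_rank_in (xU i) (enum_val i).
have fE i : enum_val (f i) = enum_val i by rewrite /f enum_rankK_in.
have finj : injective f.
  by move=> i j /(congr1 enum_val); rewrite !fE => /enum_val_inj.
have B0 := split_rest_lemx hU.
pose B := mxsub f f (split_rest (principal_submx A U)).
have := rho_lt_unitmx (B := B) _ (rho_lt_mxsub finj B0 rB).
have -> : (split_scalar (principal_submx A U))%:M - B = principal_submx A X.
  by apply/matrixP => i j; rewrite !mxE !fE (inj_eq finj); ring.
by apply=> i j; have := B0 (f i) (f j); rewrite !mxE.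
Qed.

End InvertibleSubmatrices.

Theorem theorem3 (R : realType) (m : nat) (A : 'M[R]_m) (hA : M_matrix A)
    (I J : {set 'I_m}) :
  [/\ forall p : R, 0 <= p <= 1 ->
        (tr_pow (principal_submx A I) p + tr_pow (principal_submx A J) p >=
         tr_pow (principal_submx A (I :|: J)) p +
         tr_pow (principal_submx A (I :&: J)) p)%E,
      forall p : R, p < 0 \/ 1 <= p <= 2 ->
        (tr_pow (principal_submx A I) p + tr_pow (principal_submx A J) p <=
         tr_pow (principal_submx A (I :|: J)) p +
         tr_pow (principal_submx A (I :&: J)) p)%E
    & tr_mul_log (principal_submx A I) + tr_mul_log (principal_submx A J) <=
      tr_mul_log (principal_submx A (I :|: J)) +
      tr_mul_log (principal_submx A (I :&: J))].
Proof.
have hP X := M_matrix_principal X hA.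
have concave q : 0 < q <= 1 ->
    - trace_value (pow_family (-1) q) (principal_submx A (I :|: J)) +
    - trace_value (pow_family (-1) q) (principal_submx A (I :&: J)) <=
    - trace_value (pow_family (-1) q) (principal_submx A I) +
    - trace_value (pow_family (-1) q) (principal_submx A J).
  move=> /andP[q0 q1].
  have pphi : pos_taylor_family (pow_family (-1) q) by apply: pow_family_pos; nra.
  have := trace_value_supermodular pphi I J hA (pow_family_at0 _ q0).
  by rewrite -!opprD lerN2.
split.
- move=> p /andP[]; rewrite le_eqVlt => /predU1P[<- _|p0 p1]; last first.
    have E X : tr_pow (principal_submx A X) p =
        (- trace_value (pow_family (-1) p) (principal_submx A X))%:E.
      by rewrite (@tr_pow_gt0 _ (-1) p) ?mulN1r //; nra.
    by rewrite !E -!EFinD lee_fin concave // p0.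
  have [VI [-> cI]] := tr_pow0 (hP I); have [VJ [-> cJ]] := tr_pow0 (hP J).
  have [VU [-> cU]] := tr_pow0 (hP (I :|: J)).
  have [VN [-> cN]] := tr_pow0 (hP (I :&: J)).
  rewrite -!EFinD lee_fin; apply: (ler_cvg_to (cvgD cU cN) (cvgD cI cJ)).
  near=> q; rewrite !fctE; apply: concave; apply/andP; split.
    by near: q; exact: nbhs_right_gt.
  by near: q; exact: nbhs_right_le.
- move=> p [p0|/andP[p1 p2]]; last first.
    have sp : 0 <= 1 * (p * (p - 1)) by nra.
    have p0 : 0 < p by lra.
    have E X : tr_pow (principal_submx A X) p =
        (trace_value (pow_family 1 p) (principal_submx A X))%:E.
      by rewrite (@tr_pow_gt0 _ 1 p) ?mul1r //; nra.
    rewrite !E -!EFinD lee_fin; apply: trace_value_supermodular => //.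
      exact: pow_family_pos.
    exact: pow_family_at0.
  have sp : 0 <= 1 * (p * (p - 1)) by nra.
  have p2 : p <= 2 by lra.
  have pphi := pow_family_pos p2 sp.
  have notNy X : tr_pow (principal_submx A X) p != -oo%E.
    by rewrite /tr_pow p0; case: ifP.
  have [uU|nuU] := boolP (principal_submx A (I :|: J) \in unitmx); last first.
    by rewrite {3}/tr_pow (negbTE nuU) p0 addye ?leey.
  have uX X : X \in [:: I; J; I :|: J; I :&: J] -> principal_submx A X \in unitmx.
    move=> hX; apply: (M_matrix_unit_sub hA _ uU).
    move: hX; rewrite !inE => /or4P[] /eqP -> //.
    + exact: finset.subsetUl.
    + exact: finset.subsetUr.
    + exact: fintype.subset_trans (finset.subsetIl _ _) (finset.subsetUl _ _).
  pose V X := trace_series (pow_family 1 p) (split_rest (principal_submx A X))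
                (split_scalar (principal_submx A X)).
  have E X : X \in [:: I; J; I :|: J; I :&: J] -> tr_pow (principal_submx A X) p = (V X)%:E.
    by move=> hX; rewrite /tr_pow uX // (tr_mx_pow p2 sp) ?mul1r // uX.
  rewrite !E ?inE ?eqxx ?orbT // -!EFinD lee_fin.
  apply: (limit_supermodular (V := V) pphi hA) => X hX.
  by apply: M_matrix_unit_cvg => //; exact: uX.
- rewrite !tr_mul_logE //; apply: trace_value_supermodular => //.
    exact: xlog_family_pos.
  exact: xlog_family_at0.
Unshelve. all: by end_near. Qed.
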